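(* Let $A\in M_k\otimes M_m$ be a PPT matrix with Hermitian Schmidt decomposition $A=\sum_{i=1}^n\lambda_i\gamma_i\otimes\delta_i$, where $\lambda_1=\dots=\lambda_s>\lambda_{s+1}\geq\dots\geq\lambda_n>0$. Let $D=\sum_{i=1}^s\gamma_i\otimes\delta_i$. (a) There exists a unique (up to the order of the summands) Hermitian Schmidt decomposition $D=\sum_{i=1}^s\gamma_i'\otimes\delta_i'$ such that $\gamma_i'$ and $\delta_i'$ are positive semidefinite for $1\leq i\leq s$. (b) For $1\leq i\leq s$ let $V_i\in M_k$ be the Hermitian projection onto $\Im(\gamma_i')$ and $W_i\in M_m$ the Hermitian projection onto $\Im(\delta_i')$. Let $V_{s+1}\in M_k$ be the Hermitian projection onto $(\Im(\gamma_1')\oplus\dots\oplus\Im(\gamma_s'))^{\perp}$ and $W_{s+1}\in M_m$ the Hermitian projection onto $(\Im(\delta_1')\oplus\dots\oplus\Im(\delta_s'))^{\perp}$. Then $$A=\sum_{i=1}^{s+1}(V_i\otimes W_i)A(V_i\otimes W_i),$$ and $(V_i\otimes W_i)A(V_i\otimes W_i)$ is PPT for $1\leq i\leq s+1$.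
   Context: $M_k$ denotes the complex $k\times k$ matrices, and $M_k\otimes M_m$ is identified with $M_{km}$ via the Kronecker product. $M_k$ carries the inner product $\langle C,D\rangle=\mathrm{tr}(CD^* )$. $\Im(X)$ denotes the image (column space) of a matrix $X$. A Hermitian projection is an orthogonal projection matrix. A Hermitian Schmidt decomposition of a Hermitian $A\in M_k\otimes M_m$ is an expression $A=\sum_{i=1}^n\lambda_i\gamma_i\otimes\delta_i$ with real $\lambda_i>0$, where $\{\gamma_1,\dots,\gamma_n\}\subset M_k$ and $\{\delta_1,\dots,\delta_n\}\subset M_m$ are orthonormal sets of Hermitian matrices. A positive semidefinite Hermitian matrix $A=\sum_i A_i\otimes B_i\in M_k\otimes M_m$ is PPT (positive under partial transposition) if $A^{t_1}=\sum_i A_i^t\otimes B_i$ is also positive semidefinite Hermitian. *)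

(* Defs.v *)
From mathcomp Require Import all_boot all_order all_fingroup all_algebra.
From mathcomp Require Import spectral sesquilinear.
From mathcomp.real_closed Require Import complex mxtens.
From mathcomp Require Import reals.

Set Implicit Arguments.
Unset Strict Implicit.
Unset Printing Implicit Defensive.

Import Order.TTheory GRing.Theory Num.Theory.
Local Open Scope ring_scope.
Local Open Scope sesquilinear_scope.
Local Open Scope complex_scope.

Section Definitions.
Context {R : realType}.
Local Notation C := R[i].

Definition hsdot k (X Y : 'M[C]_k) : C := \tr (X *m Y^t*).

(* On R[i], 0 <= z means that z is real and nonnegative. *)
Definition psd k (X : 'M[C]_k) : Prop :=
  X \is hermsymmx /\ forall u : 'cV[C]_k, 0 <= (u^t* *m X *m u) 0 0.

(* Partial transposition on the first factor, for the indexing of rows and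
   columns used by the Kronecker product [*t]; see [ptrans1_sum_tens]. *)
Definition ptrans1 k m (A : 'M[C]_(k * m)) : 'M[C]_(k * m) :=
  \matrix_(p, q)
    A (mxtens_index ((mxtens_unindex q).1, (mxtens_unindex p).2))
      (mxtens_index ((mxtens_unindex p).1, (mxtens_unindex q).2)).

Definition PPT k m (A : 'M[C]_(k * m)) : Prop := psd A /\ psd (ptrans1 A).

Definition orthonormal_herm n k (g : 'I_n -> 'M[C]_k) : Prop :=
  (forall i, g i \is hermsymmx) /\
  (forall i j, hsdot (g i) (g j) = (i == j)%:R).

Definition herm_schmidt n k m (A : 'M[C]_(k * m)) (l : 'I_n -> R)
    (g : 'I_n -> 'M[C]_k) (d : 'I_n -> 'M[C]_m) : Prop :=
  [/\ forall i, 0 < l i, orthonormal_herm g, orthonormal_herm d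
    & A = \sum_i (l i)%:C *: (g i *t d i)].

Definition psd_schmidt s k m (D : 'M[C]_(k * m))
    (g : 'I_s -> 'M[C]_k) (d : 'I_s -> 'M[C]_m) : Prop :=
  [/\ herm_schmidt D (fun=> 1) g d, forall i, psd (g i)
    & forall i, psd (d i)].

(* Subspaces of C^k are encoded, as in mxalgebra, as row spaces of matrices;
   the column space of X is the row space of its (unconjugated) transpose. *)
Definition im k (X : 'M[C]_k) : 'M[C]_k := X^T.

Definition orthocompl p k (U : 'M[C]_(p, k)) : 'M[C]_k :=
  orthomx Num.conj (mx_of_hermitian (hermitian1mx _)) U.

(* [proj_ortho U] projects row vectors v |-> v *m proj_ortho U; its transpose
   is the projection acting on column vectors. *)
Definition herm_proj p k (U : 'M[C]_(p, k)) : 'M[C]_k := (proj_ortho U)^T.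

(* The indices j < s give the projections onto Im (g j); the last index
   [ord_max] (that is, s + 1 when counting from 1) gives the projection onto
   the orthogonal complement of their sum. *)
Definition supp_proj s k (g : 'I_s -> 'M[C]_k) (i : 'I_s.+1) : 'M[C]_k :=
  if unlift ord_max i is Some j then herm_proj (im (g j))
  else herm_proj (orthocompl (\sum_(j < s) im (g j))%MS).

Lemma ptrans1_sum_tens (I : finType) k m (X : I -> 'M[C]_k) (Y : I -> 'M[C]_m) :
  ptrans1 (\sum_i X i *t Y i) = \sum_i (X i)^T *t Y i.
Proof.
apply/matrixP=> p q; rewrite !mxE !summxE; apply: eq_bigr => i _.
by rewrite tensmxE !mxE.
Qed.

Lemma herm_proj_idem p k (U : 'M[C]_(p, k)) :
  herm_proj U *m herm_proj U = herm_proj U.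
Proof. by rewrite -trmx_mul proj_ortho_proj. Qed.

Lemma im_herm_proj p k (U : 'M[C]_(p, k)) : (im (herm_proj U) :=: U)%MS.
Proof. by rewrite /im trmxK; apply: proj_orthoE. Qed.

Lemma herm_proj_herm p k (U : 'M[C]_(p, k)) : herm_proj U \is hermsymmx.
Proof.
set P := proj_ortho U.
have PPc : P^t* = P *m P^t*.
  have /orthomx1P : (1%:M - 1%:M *m P <= orthocompl P)%MS.
    by rewrite /orthocompl (eqmx_ortho _ (proj_orthoE U)) proj_ortho_compl_sub.
  by rewrite mul1mx mulmxBl mul1mx => /eqP; rewrite subr_eq0 => /eqP.
have Pc : P = P^t*.
  by rewrite -{1}(trmxCK P) PPc trmx_mul map_mxM trmxCK -PPc.
apply/is_hermitianmxP; rewrite expr0 scale1r /herm_proj -/P trmxK.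
by apply/matrixP => i j; rewrite [in LHS]Pc !mxE.
Qed.

End Definitions.

(* Main.v *)
Require Import Defs.
From mathcomp Require Import all_boot all_order all_fingroup all_algebra.
From mathcomp Require Import spectral sesquilinear.
From mathcomp.real_closed Require Import complex mxtens.
From mathcomp Require Import reals ring.

(** With [L] the top Schmidt coefficient, the form
    [gap X Y = L (tr X^2 + tr Y^2) - 2 tr (A (X (x) Y))] is nonnegative on pairs
    of Hermitian matrices, and vanishes exactly when [X = sum_(i < s) c_i g_i]
    and [Y = sum_(i < s) c_i d_i] for some real [c]; call such a pair top.
    As [tr (A (P (x) Q)) >= 0] for positive semidefinite [P] and [Q], the
    positive parts of a top pair form a top pair.  If [(P, Q)] is a positive
    semidefinite top pair with support projections [U] and [W], then
    [tr (A (U (x) (1 - W)))] and [tr (A ((1 - U) (x) W))] vanish; by positivity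
    of [A] and of its partial transpose, [A] is block diagonal for [U (x) W] and
    [(1 - U) (x) (1 - W)], so compressing a top pair by [U] and [W] yields a top
    pair.  These two operations turn an orthogonal family of [p < s] positive
    semidefinite top pairs into one of size [p + 1].  For uniqueness, two such
    decompositions differ by an orthogonal matrix with nonnegative entries, that
    is, by a permutation.  The same block argument with the projections [V_i]
    and [W_i] gives (b). *)

Set Implicit Arguments.
Unset Strict Implicit.
Unset Printing Implicit Defensive.

Local Open Scope ring_scope.
Local Open Scope complex_scope.

Import Order.TTheory GRing.Theory Num.Theory.
Local Open Scope sesquilinear_scope.

(** * Adjoints, traces and spectral calculus of Hermitian matrices *)

Section Hermitian.
Context {C : numClosedFieldType}.

Lemma adjmxM m n p (X : 'M[C]_(m, n)) (Y : 'M[C]_(n, p)) :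
  (X *m Y)^t* = Y^t* *m X^t*.
Proof. by rewrite trmx_mul map_mxM. Qed.

Lemma adjmxB m n (X Y : 'M[C]_(m, n)) : (X - Y)^t* = X^t* - Y^t*.
Proof. by rewrite linearB /= map_mxB. Qed.

Lemma adjmxZ m n c (X : 'M[C]_(m, n)) : (c *: X)^t* = c^* *: X^t*.
Proof. by rewrite linearZ /= map_mxZ. Qed.

Lemma adjmx1 n : (1%:M : 'M[C]_n)^t* = 1%:M.
Proof. by rewrite trmx1 map_mx1. Qed.

Lemma adjmx_sum (I : Type) (r : seq I) (P : pred I) m n
    (X : I -> 'M[C]_(m, n)) :
  (\sum_(i <- r | P i) X i)^t* = \sum_(i <- r | P i) (X i)^t*.
Proof. by rewrite linear_sum /= map_mx_sum. Qed.

Lemma hermP n {X : 'M[C]_n} : reflect (X^t* = X) (X \is hermsymmx).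
Proof.
by apply: (iffP (is_hermitianmxP _ _ _)); rewrite expr0 scale1r => {1}<-.
Qed.

Lemma herm_sum (I : Type) (r : seq I) (P : pred I) n (X : I -> 'M[C]_n) :
  (forall i, P i -> X i \is hermsymmx) ->
  \sum_(i <- r | P i) X i \is hermsymmx.
Proof.
move=> hX; apply/hermP; rewrite adjmx_sum; apply: eq_bigr => i Pi.
exact/hermP/hX.
Qed.

Lemma hermB n (X Y : 'M[C]_n) :
  X \is hermsymmx -> Y \is hermsymmx -> X - Y \is hermsymmx.
Proof. by move=> /hermP hX /hermP hY; apply/hermP; rewrite adjmxB hX hY. Qed.

Lemma hermZ n c (X : 'M[C]_n) :
  c \is Num.real -> X \is hermsymmx -> c *: X \is hermsymmx.
Proof.
by move=> /CrealP cr /hermP hX; apply/hermP; rewrite adjmxZ hX cr.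
Qed.

Lemma herm_compress n (U X : 'M[C]_n) :
  U \is hermsymmx -> X \is hermsymmx -> U *m X *m U \is hermsymmx.
Proof.
by move=> /hermP hU /hermP hX; apply/hermP; rewrite !adjmxM hU hX mulmxA.
Qed.

Lemma trmx_adj_ge0 m n (X : 'M[C]_(m, n)) : 0 <= \tr (X *m X^t*).
Proof.
rewrite /mxtrace sumr_ge0 // => i _; rewrite mxE sumr_ge0 // => j _.
by rewrite !mxE mul_conjC_ge0.
Qed.

Lemma trmx_adj_eq0 m n (X : 'M[C]_(m, n)) : \tr (X *m X^t*) = 0 -> X = 0.
Proof.
have ge0 i j : 0 <= X i j * X^t* j i by rewrite !mxE mul_conjC_ge0.
move=> /eqP; rewrite psumr_eq0 => [/allP trX0|i _]; last first.
  by rewrite mxE sumr_ge0.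
apply/matrixP => i j; have /implyP := trX0 i (mem_index_enum _).
move=> /(_ isT); rewrite mxE psumr_eq0 // => /allP /(_ j (mem_index_enum _)).
by rewrite /= !mxE mul_conjC_eq0 => /eqP.
Qed.

Lemma tr_herm_real n (X Y : 'M[C]_n) :
  X \is hermsymmx -> Y \is hermsymmx -> \tr (X *m Y) \is Num.real.
Proof.
move=> /hermP hX /hermP hY; apply/CrealP.
by rewrite -[in RHS]hX -[in RHS]hY -adjmxM trace_map_mx mxtrace_tr mxtrace_mulC.
Qed.

Lemma tr_herm_ge0 n (X : 'M[C]_n) : X \is hermsymmx -> 0 <= \tr (X *m X).
Proof. by move=> /hermP hX; have := trmx_adj_ge0 X; rewrite hX. Qed.

Lemma tr_herm_eq0 n (X : 'M[C]_n) :
  X \is hermsymmx -> \tr (X *m X) = 0 -> X = 0.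
Proof. by move=> /hermP hX trX; apply: trmx_adj_eq0; rewrite hX. Qed.

Lemma herm_spectral n (X : 'M[C]_n) : X \is hermsymmx ->
  exists (P : 'M[C]_n) (d : 'rV[C]_n), [/\ P *m P^t* = 1%:M, P^t* *m P = 1%:M,
    forall i, d 0 i \is Num.real & X = P^t* *m diag_mx d *m P].
Proof.
move=> hX; exists (spectralmx X), (spectral_diag X).
have /orthomx_spectralP Xeq := hermitian_normalmx hX.
have uP := spectral_unitarymx X.
split; first exact/unitarymxP.
- by rewrite -invmx_unitary // mulVmx // unitarymx_unit.
- by move=> i; have /mxOverP := hermitian_spectral_diag_real hX; apply.
- by rewrite {1}Xeq invmx_unitary.
Qed.

Lemma adjmx_diag n (d : 'rV[C]_n) :
  (forall i, d 0 i \is Num.real) -> (diag_mx d)^t* = diag_mx d.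
Proof.
move=> dr; rewrite tr_diag_mx map_diag_mx; congr diag_mx.
by apply/rowP => i; rewrite mxE; apply/CrealP.
Qed.

(** Evaluating the form at the eigenvectors shows that the eigenvalues are nonnegative, so [S] can
    be the diagonal of their square roots times the diagonalizing unitary. *)
Lemma herm_factor n (X : 'M[C]_n) : X \is hermsymmx ->
  (forall u : 'cV[C]_n, 0 <= (u^t* *m X *m u) 0 0) ->
  exists S : 'M[C]_n, X = S^t* *m S.
Proof.
move=> hX pX; have [P [d [PP1 P1P dr Xeq]]] := herm_spectral hX.
have d_ge0 i : 0 <= d 0 i.
  have := pX (P^t* *m delta_mx i 0).
  rewrite Xeq adjmxM trmxCK !mulmxA.
  rewrite -[_ *m P *m P^t*]mulmxA PP1 mulmx1.
  rewrite -[_ *m P *m P^t*]mulmxA PP1 mulmx1 trmx_delta map_delta_mx.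
  by rewrite -rowE -colE !mxE eqxx mulr1n.
pose e : 'rV[C]_n := map_mx sqrtC d.
have er i : e 0 i \is Num.real by rewrite mxE ger0_real // sqrtC_ge0.
exists (diag_mx e *m P); rewrite adjmxM adjmx_diag // mulmxA Xeq.
congr (_ *m P); rewrite -mulmxA mulmx_diag; congr (_ *m diag_mx _).
by apply/rowP => i; rewrite !mxE -expr2 sqrtCK.
Qed.

(** [U] is the spectral projection of [X] on its positive eigenvalues, so [U *m X] and [U *m X - X]
    are the positive and negative parts. [B] inverts the positive part on its range, which lets
    whatever the positive part annihilates pass to [U]. *)
Lemma herm_pos_part_factor n (X : 'M[C]_n) : X \is hermsymmx ->
  exists U B : 'M[C]_n,
    [/\ U \is hermsymmx, U *m U = U, U *m X = X *m U & U = B *m (U *m X)] /\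
    [/\ exists S : 'M[C]_n, U *m X = S^t* *m S
      & exists S : 'M[C]_n, U *m X - X = S^t* *m S].
Proof.
move=> hX; have [P [d [PP1 P1P dr Xeq]]] := herm_spectral hX.
(* [F f] is the functional calculus: [f] applied to the eigenvalues of [X]. By [Feq] only the values
   of [f] at real arguments matter. *)
pose F (f : C -> C) : 'M[C]_n := P^t* *m diag_mx (map_mx f d) *m P.
have FM f h : F f *m F h = F (fun x => f x * h x).
  rewrite /F !mulmxA -[_ *m P *m P^t*]mulmxA PP1 mulmx1.
  congr (_ *m P); rewrite -mulmxA mulmx_diag; congr (_ *m diag_mx _).
  by apply/rowP => i; rewrite !mxE.
have FB f h : F f - F h = F (fun x => f x - h x).
  rewrite /F -mulmxBl -mulmxBr -raddfB /=; congr (_ *m diag_mx _ *m _).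
  by apply/rowP => i; rewrite !mxE.
have Feq f h : (forall x, x \is Num.real -> f x = h x) -> F f = F h.
  move=> fh; rewrite /F; congr (_ *m diag_mx _ *m _).
  by apply/rowP => i; rewrite !mxE fh ?dr.
have Fid : F id = X by rewrite Xeq /F (map_mx_id (fun=> erefl)).
have Fherm f : (forall x, x \is Num.real -> f x \is Num.real) ->
    F f \is hermsymmx.
  move=> fr; apply/hermP; rewrite /F !adjmxM trmxCK adjmx_diag ?mulmxA // => i.
  by rewrite mxE fr ?dr.
have Fpsd f : (forall x, x \is Num.real -> 0 <= f x) ->
    exists S : 'M[C]_n, F f = S^t* *m S.
  move=> f0; exists (F (sqrtC \o f)).
  have /hermP -> : F (sqrtC \o f) \is hermsymmx.
    by apply: Fherm => x xr; rewrite ger0_real // sqrtC_ge0 f0.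
  by rewrite FM; apply: Feq => x xr; rewrite /= -expr2 sqrtCK.
pose u (x : C) : C := (0 < x)%R%:R.
exists (F u), (F (fun x => u x * x^-1)); rewrite -Fid !FM FB.
split; split.
- by apply: Fherm => x _; rewrite /u; case: (0 < x); rewrite ?real0 ?real1.
- by apply: Feq => x _; rewrite /u; case: (0 < x); rewrite ?mulr1 ?mulr0.
- by apply: Feq => x _; rewrite mulrC.
- apply: Feq => x _; rewrite /u; case x0: (0 < x); rewrite ?mul0r // !mul1r.
  by rewrite mulVf // gt_eqF.
- apply: Fpsd => x xr; rewrite /u.
  by case x0: (0 < x); rewrite ?mul0r // ?mul1r ltW.
- apply: Fpsd => x xr; rewrite /u real_ltNge //.
  case: (boolP (x <= 0)) => x0 /=; last by rewrite mul1r subrr.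
  by rewrite mul0r sub0r oppr_ge0.
Qed.
Lemma tr_gram n (S T : 'M[C]_n) :
  \tr (S^t* *m S *m (T^t* *m T)) = \tr (S *m T^t* *m (S *m T^t*)^t*).
Proof. by rewrite adjmxM trmxCK -mulmxA mxtrace_mulC !mulmxA. Qed.
End Hermitian.

(** * Positive semidefinite matrices as Gram matrices *)

Section Psd.
Context {R : realType}.
Local Notation C := R[i].

Lemma adjmx_tens m n p q (X : 'M[C]_(m, n)) (Y : 'M[C]_(p, q)) :
  (X *t Y)^t* = X^t* *t Y^t*.
Proof. by rewrite trmx_tens map_mxT. Qed.

Lemma hsdotE n (X Y : 'M[C]_n) :
  Y \is hermsymmx -> hsdot X Y = \tr (X *m Y).
Proof. by move=> /hermP hY; rewrite /hsdot hY. Qed.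

Lemma psdP n (X : 'M[C]_n) : psd X <-> exists S : 'M[C]_n, X = S^t* *m S.
Proof.
split=> [[hX pX]|[S ->]]; first exact: herm_factor.
split; first by apply/hermP; rewrite adjmxM trmxCK.
move=> u; rewrite mulmxA -mulmxA -adjmxM.
have := trmx_adj_ge0 ((S *m u)^t*).
by rewrite trmxCK [X in \tr X]mx11_scalar mxtrace_scalar.
Qed.

Lemma psd_herm n (X : 'M[C]_n) : psd X -> X \is hermsymmx.
Proof. by case. Qed.

Lemma psd_tens m n (X : 'M[C]_m) (Y : 'M[C]_n) : psd X -> psd Y -> psd (X *t Y).
Proof.
move=> /psdP[S ->] /psdP[T ->]; apply/psdP; exists (S *t T).
by rewrite adjmx_tens tensmx_mul.
Qed.

Lemma psd_conj n (S X : 'M[C]_n) : psd X -> psd (S^t* *m X *m S).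
Proof.
by move=> /psdP[T ->]; apply/psdP; exists (T *m S); rewrite adjmxM !mulmxA.
Qed.

Lemma psd_compress n (U X : 'M[C]_n) :
  U \is hermsymmx -> psd X -> psd (U *m X *m U).
Proof. by move=> /hermP hU pX; rewrite -{1}hU; apply: psd_conj. Qed.

Lemma psd_proj n (U : 'M[C]_n) : U \is hermsymmx -> U *m U = U -> psd U.
Proof. by move=> /hermP hU UU; apply/psdP; exists U; rewrite hU. Qed.

Lemma psd_trmx n (X : 'M[C]_n) : psd X -> psd X^T.
Proof.
move=> /psdP[S ->]; apply/psdP; exists (map_mx Num.conj S).
by rewrite trmx_mul; congr (_ *m _); apply/matrixP => i j; rewrite !mxE ?conjCK.
Qed.

Lemma psdZ n (c : C) (X : 'M[C]_n) : 0 <= c -> psd X -> psd (c *: X).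
Proof.
move=> c0 [hX pX]; split; first by rewrite hermZ // ger0_real.
by move=> u; rewrite -scalemxAr -scalemxAl mxE mulr_ge0.
Qed.

Lemma psd_tr_ge0 n (X Y : 'M[C]_n) : psd X -> psd Y -> 0 <= \tr (X *m Y).
Proof.
by move=> /psdP[S ->] /psdP[T ->]; rewrite tr_gram trmx_adj_ge0.
Qed.

(** With Gram factors [S] and [T], the trace is the squared norm of [S *m T^t*], a factor sitting in
    the middle of [X *m Y]. *)
Lemma psd_tr_eq0 n (X Y : 'M[C]_n) :
  psd X -> psd Y -> \tr (X *m Y) = 0 -> X *m Y = 0.
Proof.
move=> /psdP[S ->] /psdP[T ->]; rewrite tr_gram => /trmx_adj_eq0 ST0.
by rewrite -!mulmxA [S *m (_ *m _)]mulmxA ST0 mul0mx mulmx0.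
Qed.

Lemma herm_pos_part n (X : 'M[C]_n) : X \is hermsymmx ->
  exists U B : 'M[C]_n,
    [/\ U \is hermsymmx, U *m U = U, U *m X = X *m U & U = B *m (U *m X)] /\
    [/\ psd (U *m X) & psd (U *m X - X)].
Proof.
move=> /herm_pos_part_factor [U [B [UB [p1 p2]]]].
by exists U, B; split => //; split; apply/psdP.
Qed.
End Psd.

(** * Kronecker products: bilinearity, traces and expansion in matrix units *)

Section Tensor.
Context {C : numClosedFieldType}.

(** Writing [A] as a sum of elementary tensors reduces linear identities, in particular those on
    [ptrans1], to a single tensor. *)
Lemma tens_decomp k m (A : 'M[C]_(k * m)) :
  A = \sum_(ij : 'I_k * 'I_k) delta_mx ij.1 ij.2 *t
        (\matrix_(a, b) A (mxtens_index (ij.1, a)) (mxtens_index (ij.2, b))).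
Proof.
apply/matrixP => p q; case: (mxtens_indexP p) => /= i a.
case: (mxtens_indexP q) => /= j b; rewrite summxE (bigD1 (i, j)) //=.
rewrite tensmxE !mxE !eqxx mul1r big1 ?addr0 // => -[i' j'] /= ne.
rewrite tensmxE !mxE; case: eqP => [ii|]; last by rewrite mul0r.
by case: eqP => [jj|]; [rewrite ii jj eqxx in ne | rewrite mul0r].
Qed.

Lemma mxtrace_tens m n (X : 'M[C]_m) (Y : 'M[C]_n) :
  \tr (X *t Y) = \tr X * \tr Y.
Proof. by rewrite /mxtrace mulr_sum; apply: eq_bigr => i _; rewrite mxE. Qed.

Lemma tensmxDl m n p q (X X' : 'M[C]_(m, n)) (Y : 'M[C]_(p, q)) :
  (X + X') *t Y = X *t Y + X' *t Y.
Proof. by apply/matrixP => i j; rewrite !mxE mulrDl. Qed.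

Lemma tensmxDr m n p q (X : 'M[C]_(m, n)) (Y Y' : 'M[C]_(p, q)) :
  X *t (Y + Y') = X *t Y + X *t Y'.
Proof. by apply/matrixP => i j; rewrite !mxE mulrDr. Qed.

Lemma tensmxZl m n p q c (X : 'M[C]_(m, n)) (Y : 'M[C]_(p, q)) :
  (c *: X) *t Y = c *: (X *t Y).
Proof. by apply/matrixP => i j; rewrite !mxE mulrA. Qed.

Lemma tensmxZr m n p q c (X : 'M[C]_(m, n)) (Y : 'M[C]_(p, q)) :
  X *t (c *: Y) = c *: (X *t Y).
Proof. by apply/matrixP => i j; rewrite !mxE mulrCA. Qed.

Lemma tensmx_suml (I : Type) (r : seq I) (P : pred I) m n p q
    (X : I -> 'M[C]_(m, n)) (Y : 'M[C]_(p, q)) :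
  (\sum_(i <- r | P i) X i) *t Y = \sum_(i <- r | P i) X i *t Y.
Proof.
apply: (big_morph (fun Z => Z *t Y)) => [Z Z'|]; first exact: tensmxDl.
exact: tens0mx.
Qed.

Lemma tensmx_sumr (I : Type) (r : seq I) (P : pred I) m n p q
    (X : 'M[C]_(m, n)) (Y : I -> 'M[C]_(p, q)) :
  X *t (\sum_(i <- r | P i) Y i) = \sum_(i <- r | P i) X *t Y i.
Proof.
apply: (big_morph (fun Z => X *t Z)) => [Z Z'|]; first exact: tensmxDr.
exact: tensmx0.
Qed.

Lemma tensmx11 m n : (1%:M : 'M[C]_m) *t (1%:M : 'M[C]_n) = 1%:M.
Proof.
apply/matrixP => p q; case: (mxtens_indexP p) => /= i a.
case: (mxtens_indexP q) => /= j b; rewrite tensmxE !mxE.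
rewrite (can_eq (@mxtens_indexK m n)) xpair_eqE.
by case: (i == j); case: (a == b); rewrite ?mulr1 ?mulr0.
Qed.

Lemma tensmxNN m n p q (X : 'M[C]_(m, n)) (Y : 'M[C]_(p, q)) :
  (- X) *t (- Y) = X *t Y.
Proof. by apply/matrixP => i j; rewrite !mxE mulrNN. Qed.
Lemma sum_tens_mulmx (I : finType) k m (X : I -> 'M[C]_k) (Y : I -> 'M[C]_m)
    (V V' : 'M[C]_k) (W W' : 'M[C]_m) :
  (V *t W) *m (\sum_i X i *t Y i) *m (V' *t W') =
  \sum_i (V *m X i *m V') *t (W *m Y i *m W').
Proof.
rewrite mulmx_sumr mulmx_suml; apply: eq_bigr => i _.
by rewrite !tensmx_mul.
Qed.

Lemma tr_sum_tens (I : finType) k m (X : I -> 'M[C]_k) (Y : I -> 'M[C]_m)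
    (V : 'M[C]_k) (W : 'M[C]_m) :
  \tr ((\sum_i X i *t Y i) *m (V *t W)) =
  \sum_i \tr (X i *m V) * \tr (Y i *m W).
Proof.
rewrite mulmx_suml raddf_sum; apply: eq_bigr => i _ /=.
by rewrite tensmx_mul mxtrace_tens.
Qed.
End Tensor.

(** * Partial transposition and block diagonal PPT matrices *)

Section PartialTranspose.
Context {R : realType}.
Local Notation C := R[i].

Lemma ptrans1K k m (A : 'M[C]_(k * m)) : ptrans1 (ptrans1 A) = A.
Proof.
apply/matrixP => p q; case: (mxtens_indexP p) => /= i a.
by case: (mxtens_indexP q) => /= j b; rewrite !mxE !mxtens_indexK.
Qed.

(** On an elementary tensor, transposing the first factor reverses [V *m X *m V']; so the outer
    first factors trade sides while the second factors stay. *)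
Lemma ptrans1_mulmx k m (V V' : 'M[C]_k) (W W' : 'M[C]_m) (A : 'M[C]_(k * m)) :
  ptrans1 ((V *t W) *m A *m (V' *t W')) =
  (V'^T *t W) *m ptrans1 A *m (V^T *t W').
Proof.
rewrite [A]tens_decomp ptrans1_sum_tens !sum_tens_mulmx ptrans1_sum_tens.
by apply: eq_bigr => i _; rewrite !trmx_mul mulmxA.
Qed.

Lemma mxtrace_ptrans1 k m (V : 'M[C]_k) (W : 'M[C]_m) (A : 'M[C]_(k * m)) :
  \tr (ptrans1 A *m (V^T *t W)) = \tr (A *m (V *t W)).
Proof.
rewrite [A]tens_decomp ptrans1_sum_tens !tr_sum_tens; apply: eq_bigr => i _.
by rewrite -trmx_mul mxtrace_tr mxtrace_mulC.
Qed.

Lemma PPT_compress k m (V : 'M[C]_k) (W : 'M[C]_m) (A : 'M[C]_(k * m)) :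
  V \is hermsymmx -> W \is hermsymmx -> PPT A ->
  PPT ((V *t W) *m A *m (V *t W)).
Proof.
move=> /hermP hV /hermP hW [pA pA1]; split.
  by apply: psd_compress => //; apply/hermP; rewrite adjmx_tens hV hW.
rewrite ptrans1_mulmx; apply: psd_compress => //; apply/hermP.
by rewrite adjmx_tens hW; congr (_ *t _); rewrite -map_trmx hV.
Qed.

(** The partial transpose has the same trace against [V^T *t W], so one vanishing trace kills a
    product with each of the two positive semidefinite matrices. *)
Lemma PPT_tr_eq0 k m (V : 'M[C]_k) (W : 'M[C]_m) (A : 'M[C]_(k * m)) :
  PPT A -> psd V -> psd W -> \tr (A *m (V *t W)) = 0 ->
  A *m (V *t W) = 0 /\ ptrans1 A *m (V^T *t W) = 0.
Proof.
move=> [pA pA1] pV pW tr0; split.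
  exact: psd_tr_eq0 pA (psd_tens pV pW) tr0.
apply: psd_tr_eq0 pA1 (psd_tens (psd_trmx pV) pW) _.
by rewrite mxtrace_ptrans1.
Qed.

(* The partial transpose of an off-diagonal block
   [(V_i (x) W_i) A (V_j (x) W_j)] is
   [(V_j^T (x) W_i) (ptrans1 A) (V_i^T (x) W_j)], which vanishes because
   [ptrans1 A] is positive semidefinite. *)
Lemma PPT_block_diag (I : finType) k m (V : I -> 'M[C]_k) (W : I -> 'M[C]_m)
    (A : 'M[C]_(k * m)) :
  PPT A -> (forall i, psd (V i)) -> (forall i, psd (W i)) ->
  \sum_i V i = 1%:M -> \sum_i W i = 1%:M ->
  (forall i j, i != j -> \tr (A *m (V i *t W j)) = 0) ->
  A = \sum_i (V i *t W i) *m A *m (V i *t W i).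
Proof.
move=> PA pV pW V1 W1 tr0.
have VW1 : \sum_i \sum_j V i *t W j = 1%:M.
  rewrite -tensmx11 -V1 -W1 tensmx_suml; apply: eq_bigr => i _.
  by rewrite tensmx_sumr.
have AVW i j : i != j -> A *m (V i *t W j) = 0.
  by move=> ij; have [] := PPT_tr_eq0 PA (pV i) (pW j) (tr0 i j ij).
have VWA i j : i != j -> (V i *t W j) *m A = 0.
  move=> ij; have := congr1 (fun Z => Z^t*) (AVW i j ij).
  rewrite adjmxM adjmx_tens (hermP (psd_herm (pV i))) (hermP (psd_herm (pW j))).
  by rewrite (hermP (psd_herm PA.1)) trmx0 map_mx0.
(* The identity is inserted on the right, then on the left; the mixed tensors vanish, leaving the
   blocks [(V i *t W i) *m A *m (V j *t W j)]. *)
have sumR (Z : 'M[C]_(k * m)) : Z *m A = Z *m A *m \sum_i V i *t W i.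
  rewrite -[LHS]mulmx1 -VW1 mulmx_sumr mulmx_sumr; apply: eq_bigr => i _.
  rewrite mulmx_sumr (bigD1 i) //= big1 ?addr0 // => j ji.
  by rewrite -mulmxA AVW ?mulmx0 // eq_sym.
have sumL : A = (\sum_i V i *t W i) *m A.
  rewrite -[LHS]mul1mx -VW1 !mulmx_suml; apply: eq_bigr => i _.
  rewrite mulmx_suml (bigD1 i) //= big1 ?addr0 // => j ji.
  by rewrite VWA // eq_sym.
rewrite {1}sumL sumR !mulmx_suml; apply: eq_bigr => i _.
rewrite mulmx_sumr (bigD1 i) //= big1 ?addr0 // => j ji.
rewrite -[LHS]ptrans1K ptrans1_mulmx -mulmxA.
have [|_ ->] := PPT_tr_eq0 PA (pV i) (pW j); first by rewrite tr0 // eq_sym.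
by rewrite mulmx0; apply/matrixP => p q; rewrite !mxE.
Qed.
End PartialTranspose.

(** * The gap form: Schmidt expansion, positivity and zeros *)

Section Gap.
Context {C : numClosedFieldType}.

(* The pairs of Hermitian matrices where this form vanishes are the pairs of
   singular vectors of [A] for the top Schmidt coefficient [L]. *)
Definition gap (L : C) k m (A : 'M[C]_(k * m)) (X : 'M[C]_k) (Y : 'M[C]_m) :=
  L * (\tr (X *m X) + \tr (Y *m Y)) - 2%:R * \tr (A *m (X *t Y)).

(** Hermitian matrices are their own adjoints, so the adjoint of the inner product is dropped and
    the pairing becomes bilinear. *)
Definition orthonormal n k (g : 'I_n -> 'M[C]_k) :=
  (forall i, g i \is hermsymmx) /\
  (forall i j, \tr (g i *m g j) = (i == j)%:R).

Lemma tr_orthonormal_sum n k (g : 'I_n -> 'M[C]_k) (T : pred 'I_n)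
    (c : 'I_n -> C) i :
  orthonormal g ->
  \tr (g i *m \sum_(j | T j) c j *: g j) = if T i then c i else 0.
Proof.
move=> go; rewrite mulmx_sumr raddf_sum /=.
under eq_bigr => j _.
  rewrite -scalemxAr mxtraceZ go.2; over.
rewrite big_mkcond (bigD1 i) //= eqxx mulr1 big1 ?addr0 // => j ji.
by rewrite eq_sym (negPf ji) mulr0 if_same.
Qed.

(** Pythagoras for the bilinear trace form: the residual [Z] is orthogonal to every [g i]. *)
Lemma bessel n k (g : 'I_n -> 'M[C]_k) (X : 'M[C]_k) :
  orthonormal g ->
  let Z := X - \sum_i \tr (g i *m X) *: g i in
  \tr (X *m X) = \tr (Z *m Z) + \sum_i \tr (g i *m X) ^+ 2.
Proof.
move=> go /=; set S := \sum_i \tr (g i *m X) *: g i.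
have gS i : \tr (g i *m S) = \tr (g i *m X) by rewrite tr_orthonormal_sum.
have SE Y : \tr (S *m Y) = \sum_i \tr (g i *m X) * \tr (g i *m Y).
  rewrite mulmx_suml raddf_sum /=; apply: eq_bigr => i _.
  by rewrite -scalemxAl mxtraceZ.
have SX : \tr (S *m X) = \sum_i \tr (g i *m X) ^+ 2 by rewrite SE.
have SS : \tr (S *m S) = \sum_i \tr (g i *m X) ^+ 2.
  by rewrite SE; apply: eq_bigr => i _; rewrite gS.
rewrite mulmxBl !mulmxBr !raddfB /= [\tr (X *m S)]mxtrace_mulC SX SS; ring.
Qed.

Lemma gap_scale L k m (A : 'M[C]_(k * m)) c X Y :
  gap L A (c *: X) (c *: Y) = c ^+ 2 * gap L A X Y.
Proof.
rewrite /gap tensmxZl tensmxZr -!scalemxAl -!scalemxAr !mxtraceZ; ring.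
Qed.

(** The products [P *m N] and [Q *m M] vanish, so the squares add up without cross terms; the mixed
    tensors enter the pairing with [A] with a minus sign. For positive semidefinite parts and PPT
    [A] the last summand is therefore nonnegative. *)
Lemma gapB L k m (A : 'M[C]_(k * m)) P N Q M : P *m N = 0 -> Q *m M = 0 ->
  gap L A (P - N) (Q - M) = gap L A P Q + gap L A N M +
    2%:R * (\tr (A *m (P *t M)) + \tr (A *m (N *t Q))).
Proof.
have trsq k' (V W : 'M[C]_k') : V *m W = 0 ->
    \tr ((V - W) *m (V - W)) = \tr (V *m V) + \tr (W *m W).
  move=> VW; rewrite mulmxBl !mulmxBr !raddfB /= [\tr (W *m V)]mxtrace_mulC.
  rewrite VW mxtrace0; ring.
move=> PN QM; rewrite /gap !trsq // tensmxDl !tensmxDr tensmxNN.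
have -> : P *t (- M) = - (P *t M) by rewrite -scaleN1r tensmxZr scaleN1r.
have -> : (- N) *t Q = - (N *t Q) by rewrite -scaleN1r tensmxZl scaleN1r.
rewrite !mulmxDr !mulmxN !mxtraceD !raddfN /=; ring.
Qed.

(** The squared norm of [X] is the sum of those of its blocks, here separated into diagonal and
    off-diagonal ones. *)
Lemma tr_herm_blocks (I : finType) k (V : I -> 'M[C]_k) X :
  (forall i, V i \is hermsymmx) -> (forall i, V i *m V i = V i) ->
  \sum_i V i = 1%:M -> X \is hermsymmx ->
  \tr (X *m X) = \sum_i \tr (V i *m X *m V i *m (V i *m X *m V i)) +
    \sum_i \sum_(j | j != i) \tr (V i *m X *m V j *m (V i *m X *m V j)^t*).
Proof.
move=> hV VV V1 hX.
have blk i j : \tr (V i *m X *m V j *m (V i *m X *m V j)^t*) =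
    \tr (V i *m X *m V j *m X).
  rewrite !adjmxM (hermP hX) !(hermP (hV _)) !mulmxA.
  rewrite -[_ *m V j *m V j]mulmxA VV.
  by rewrite mxtrace_mulC !mulmxA VV.
have -> : \tr (X *m X) = \sum_i \sum_j \tr (V i *m X *m V j *m X).
  rewrite -[X in X *m _]mul1mx -[X in X *m _]mulmx1 -V1 !mulmx_suml raddf_sum.
  apply: eq_bigr => i _; rewrite mulmx_sumr mulmx_suml raddf_sum.
  by apply: eq_bigr => j _.
rewrite -big_split; apply: eq_bigr => i _ /=; rewrite (bigD1 i) //=.
congr (_ + _); last by apply: eq_bigr => j _; rewrite blk.
by rewrite -blk !adjmxM (hermP hX) !(hermP (hV _)) !mulmxA.
Qed.

(** The pairing with a block diagonal [A] sees only the diagonal blocks of [X] and [Y], while the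
    squared norms also count the off-diagonal ones; these make up the remainder. *)
Lemma gap_blocks L (I : finType) k m (V : I -> 'M[C]_k) (W : I -> 'M[C]_m)
    (A : 'M[C]_(k * m)) X Y :
  (forall i, V i \is hermsymmx) -> (forall i, V i *m V i = V i) ->
  \sum_i V i = 1%:M -> X \is hermsymmx ->
  (forall i, W i \is hermsymmx) -> (forall i, W i *m W i = W i) ->
  \sum_i W i = 1%:M -> Y \is hermsymmx ->
  A = \sum_i (V i *t W i) *m A *m (V i *t W i) ->
  gap L A X Y = \sum_i gap L A (V i *m X *m V i) (W i *m Y *m W i) +
    L * (\sum_i \sum_(j | j != i)
           \tr (V i *m X *m V j *m (V i *m X *m V j)^t*) +
         \sum_i \sum_(j | j != i)
           \tr (W i *m Y *m W j *m (W i *m Y *m W j)^t*)).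
Proof.
move=> hV VV V1 hX hW WW W1 hY AE.
have trA : \tr (A *m (X *t Y)) =
    \sum_i \tr (A *m ((V i *m X *m V i) *t (W i *m Y *m W i))).
  rewrite {1}AE mulmx_suml raddf_sum; apply: eq_bigr => i _ /=.
  by rewrite -!mulmxA mxtrace_mulC -!mulmxA !tensmx_mul !mulmxA.
rewrite /gap (tr_herm_blocks hV VV V1 hX) (tr_herm_blocks hW WW W1 hY) trA.
rewrite sumrB -!mulr_sumr big_split /=; ring.
Qed.

Section Schmidt.
Context (n k m : nat) (T : pred 'I_n) (L : C) (a : 'I_n -> C).
Context (g : 'I_n -> 'M[C]_k) (d : 'I_n -> 'M[C]_m).
Hypotheses (L_gt0 : 0 < L) (aT : forall i, T i -> a i = L)
  (aNT : forall i, ~~ T i -> 0 <= a i < L).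
Hypotheses (g_on : orthonormal g) (d_on : orthonormal d).
Let A : 'M[C]_(k * m) := \sum_i a i *: (g i *t d i).

Lemma tr_schmidt X Y :
  \tr (A *m (X *t Y)) = \sum_i a i * (\tr (g i *m X) * \tr (d i *m Y)).
Proof.
rewrite /A mulmx_suml raddf_sum /=; apply: eq_bigr => i _.
by rewrite -scalemxAl mxtraceZ tensmx_mul mxtrace_tens.
Qed.

(** After the Bessel expansion, complete the square in each coordinate: L (x^2 + y^2) - 2 a x y = (L
    - a) (x^2 + y^2) + a (x - y)^2. *)
Lemma gapE X Y :
  let Zx := X - \sum_i \tr (g i *m X) *: g i in
  let Zy := Y - \sum_i \tr (d i *m Y) *: d i in
  gap L A X Y = L * \tr (Zx *m Zx) + L * \tr (Zy *m Zy) +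
    \sum_i ((L - a i) * (\tr (g i *m X) ^+ 2 + \tr (d i *m Y) ^+ 2) +
            a i * (\tr (g i *m X) - \tr (d i *m Y)) ^+ 2).
Proof.
move=> Zx Zy; rewrite /gap (bessel X g_on) (bessel Y d_on) -/Zx -/Zy tr_schmidt.
set tx := \tr (Zx *m Zx); set ty := \tr (Zy *m Zy).
have -> : \sum_i ((L - a i) * (\tr (g i *m X) ^+ 2 + \tr (d i *m Y) ^+ 2) +
    a i * (\tr (g i *m X) - \tr (d i *m Y)) ^+ 2) =
    L * \sum_i \tr (g i *m X) ^+ 2 + L * \sum_i \tr (d i *m Y) ^+ 2 -
    2%:R * \sum_i a i * (\tr (g i *m X) * \tr (d i *m Y)).
  rewrite !mulr_sumr -big_split -sumrB; apply: eq_bigr => i _ /=; ring.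
ring.
Qed.

Let a_ge0 i : 0 <= a i.
Proof. by case: (boolP (T i)) => [/aT ->|/aNT /andP[]//]; rewrite ltW. Qed.

Let La_ge0 i : 0 <= L - a i.
Proof.
case: (boolP (T i)) => [/aT ->|/aNT /andP[_ aL]]; first by rewrite subrr.
by rewrite subr_ge0 ltW.
Qed.

Let gap_terms X Y : X \is hermsymmx -> Y \is hermsymmx ->
  let Zx := X - \sum_i \tr (g i *m X) *: g i in
  let Zy := Y - \sum_i \tr (d i *m Y) *: d i in
  [/\ Zx \is hermsymmx, Zy \is hermsymmx,
    forall i, 0 <= (L - a i) * (\tr (g i *m X) ^+ 2 + \tr (d i *m Y) ^+ 2)
  & forall i, 0 <= a i * (\tr (g i *m X) - \tr (d i *m Y)) ^+ 2].
Proof.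
move=> hX hY Zx Zy; have gr i := tr_herm_real (g_on.1 i) hX.
have dr i := tr_herm_real (d_on.1 i) hY.
split.
- by rewrite hermB ?herm_sum // => i _; rewrite hermZ // g_on.1.
- by rewrite hermB ?herm_sum // => i _; rewrite hermZ // d_on.1.
- by move=> i; rewrite mulr_ge0 ?La_ge0 ?addr_ge0 -?realEsqr.
- by move=> i; rewrite mulr_ge0 ?a_ge0 // -realEsqr realB.
Qed.

Lemma gap_ge0 X Y : X \is hermsymmx -> Y \is hermsymmx -> 0 <= gap L A X Y.
Proof.
move=> hX hY; have [hZx hZy t1 t2] := gap_terms hX hY.
rewrite gapE !addr_ge0 ?mulr_ge0 ?tr_herm_ge0 ?(ltW L_gt0) ?sumr_ge0 // => i _.
by rewrite addr_ge0.
Qed.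

(** All terms of [gapE] are nonnegative, hence zero: the residuals vanish, the coordinates of [X]
    and [Y] agree where [a i = L], and they vanish where [a i < L]. *)
Lemma gap_eq0 X Y : X \is hermsymmx -> Y \is hermsymmx -> gap L A X Y = 0 ->
  X = \sum_(i | T i) \tr (g i *m X) *: g i /\
  Y = \sum_(i | T i) \tr (g i *m X) *: d i.
Proof.
move=> hX hY /eqP; have [hZx hZy t1 t2] := gap_terms hX hY.
have trZx := tr_herm_ge0 hZx; have trZy := tr_herm_ge0 hZy.
have L0 := ltW L_gt0; have L_neq0 : L != 0 by rewrite gt_eqF.
have t_ge0 i := addr_ge0 (t1 i) (t2 i).
have [Lx_ge0 Ly_ge0] := (mulr_ge0 L0 trZx, mulr_ge0 L0 trZy).
rewrite gapE paddr_eq0 ?(addr_ge0 Lx_ge0 Ly_ge0) ?sumr_ge0 //.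
rewrite paddr_eq0 // !mulf_eq0 (negPf L_neq0) /=.
case/andP => /andP[/eqP /(tr_herm_eq0 hZx)/subr0_eq X_eq].
move=> /eqP /(tr_herm_eq0 hZy)/subr0_eq Y_eq; rewrite psumr_eq0 // => /allP t0.
have {}t0 i : (L - a i) * (\tr (g i *m X) ^+ 2 + \tr (d i *m Y) ^+ 2) = 0 /\
    a i * (\tr (g i *m X) - \tr (d i *m Y)) ^+ 2 = 0.
  have := t0 i (mem_index_enum _); rewrite /= paddr_eq0 //.
  by case/andP => /eqP -> /eqP ->.
have xT i : T i -> \tr (d i *m Y) = \tr (g i *m X).
  move=> Ti; have [_ /eqP] := t0 i; rewrite aT // mulf_eq0 (negPf L_neq0) /=.
  by rewrite expf_eq0 /= subr_eq0 => /eqP ->.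
have xNT i : ~~ T i -> \tr (g i *m X) = 0 /\ \tr (d i *m Y) = 0.
  move=> /aNT /andP[_ aL]; have [/eqP + _] := t0 i.
  have x0 : 0 <= \tr (g i *m X) ^+ 2 by rewrite -realEsqr tr_herm_real ?g_on.1.
  have y0 : 0 <= \tr (d i *m Y) ^+ 2 by rewrite -realEsqr tr_herm_real ?d_on.1.
  rewrite mulf_eq0 subr_eq0 gt_eqF //= paddr_eq0 //.
  by rewrite !expf_eq0 /= => /andP[/eqP -> /eqP ->].
split; [rewrite {1}X_eq | rewrite {1}Y_eq]; rewrite [RHS]big_mkcond /=.
  apply: eq_bigr => i _; case: ifPn => // /xNT [-> _].
  by rewrite scale0r.
apply: eq_bigr => i _; case: ifPn => [/xT -> //|/xNT [_ ->]].
by rewrite scale0r.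
Qed.

Lemma gap_span (c : 'I_n -> C) :
  gap L A (\sum_(i | T i) c i *: g i) (\sum_(i | T i) c i *: d i) = 0.
Proof.
have trT k' (f : 'I_n -> 'M[C]_k') i : orthonormal f ->
    \tr (f i *m \sum_(j | T j) c j *: f j) = if T i then c i else 0.
  exact: tr_orthonormal_sum.
have Z0 k' (f : 'I_n -> 'M[C]_k') : orthonormal f ->
    let X := \sum_(i | T i) c i *: f i in
    X - \sum_i \tr (f i *m X) *: f i = 0.
  move=> fo /=; rewrite [X in X - _]big_mkcond -sumrB big1 // => i _.
  by rewrite trT //; case: ifP; rewrite ?scale0r subrr.
rewrite gapE !Z0 // !mulmx0 !mxtrace0 !mulr0 !add0r big1 // => i _.
rewrite !trT //; case: ifP => [/aT ->|_]; last by ring.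
by rewrite !subrr; ring.
Qed.

(** This is the singular vector equation at the coefficient [L], tested against an arbitrary [Z]:
    the common coordinates of [X] and [Y] live only where [a i = L]. *)
Lemma tr_gap_eq0 X Y Z : X \is hermsymmx -> Y \is hermsymmx ->
  gap L A X Y = 0 ->
  \tr (A *m (X *t Z)) = L * \tr (Y *m Z).
Proof.
move=> hX hY /(gap_eq0 hX hY)[X_eq Y_eq]; rewrite tr_schmidt.
have gX i : \tr (g i *m X) = if T i then \tr (g i *m X) else 0.
  by rewrite {1}X_eq tr_orthonormal_sum.
rewrite Y_eq mulmx_suml raddf_sum mulr_sumr [RHS]big_mkcond /=.
apply: eq_bigr => i _; rewrite gX.
case: ifPn => [Ti|_]; last by rewrite mul0r mulr0.
by rewrite aT // -scalemxAl mxtraceZ.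
Qed.

Lemma tr_gap_eq0r X Y Z : X \is hermsymmx -> Y \is hermsymmx ->
  gap L A X Y = 0 ->
  \tr (A *m (Z *t Y)) = L * \tr (X *m Z).
Proof.
move=> hX hY /(gap_eq0 hX hY)[X_eq Y_eq]; rewrite tr_schmidt.
have dY i : \tr (d i *m Y) = if T i then \tr (g i *m X) else 0.
  by rewrite {1}Y_eq (tr_orthonormal_sum T (fun i => \tr (g i *m X))).
rewrite {1}X_eq mulmx_suml raddf_sum mulr_sumr [RHS]big_mkcond /=.
apply: eq_bigr => i _; rewrite dY.
case: ifPn => [Ti|_]; last by rewrite !mulr0.
by rewrite aT // -scalemxAl mxtraceZ [_ * \tr (g i *m X)]mulrC.
Qed.
End Schmidt.
End Gap.

(** * Top pairs and their compression to blocks *)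

Section TopPair.
Context {C : numClosedFieldType}.

Definition top_pair (L : C) k m (A : 'M[C]_(k * m))
    (X : 'M[C]_k) (Y : 'M[C]_m) :=
  [/\ X \is hermsymmx, Y \is hermsymmx & gap L A X Y = 0].

Lemma top_pairZ L k m (A : 'M[C]_(k * m)) c X Y :
  c \is Num.real -> top_pair L A X Y -> top_pair L A (c *: X) (c *: Y).
Proof.
move=> cr [hX hY g0]; split; rewrite ?hermZ //.
by rewrite gap_scale g0 mulr0.
Qed.

Lemma herm_compl k (U : 'M[C]_k) : U \is hermsymmx -> 1%:M - U \is hermsymmx.
Proof. by move=> hU; rewrite hermB //; apply/hermP; rewrite adjmx1. Qed.

Lemma herm_fixC k (U X : 'M[C]_k) :
  U \is hermsymmx -> X \is hermsymmx -> U *m X = X -> X *m U = X.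
Proof.
by move=> /hermP hU /hermP hX UX; rewrite -{1}hX -hU -adjmxM UX hX.
Qed.

Lemma mulmx_compl_eq0 k (X U : 'M[C]_k) : X *m (1%:M - U) = 0 -> X *m U = X.
Proof. by rewrite mulmxBr mulmx1 => /subr0_eq. Qed.

Lemma idem_compl k (U : 'M[C]_k) :
  U *m U = U -> (1%:M - U) *m (1%:M - U) = 1%:M - U.
Proof. by move=> UU; rewrite mulmxBr mulmx1 mulmxBl mul1mx UU subrr subr0. Qed.

Lemma idem_pos_part k (U X : 'M[C]_k) :
  U *m U = U -> U *m X = X *m U -> U *m X *m (U *m X - X) = 0.
Proof.
move=> UU UX; rewrite mulmxBr {1}UX -mulmxA [U *m (U *m X)]mulmxA UU mulmxA.
by rewrite -UX subrr.
Qed.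

(** Every summand of [gap_blocks] is nonnegative, so a zero total makes the diagonal blocks top
    pairs and, as [0 < L], annihilates the off-diagonal blocks. *)
Lemma gap_blocks_eq0 L (I : finType) k m (V : I -> 'M[C]_k) (W : I -> 'M[C]_m)
    (A : 'M[C]_(k * m)) X Y : 0 < L ->
  (forall X Y, X \is hermsymmx -> Y \is hermsymmx -> 0 <= gap L A X Y) ->
  (forall i, V i \is hermsymmx) -> (forall i, V i *m V i = V i) ->
  \sum_i V i = 1%:M ->
  (forall i, W i \is hermsymmx) -> (forall i, W i *m W i = W i) ->
  \sum_i W i = 1%:M ->
  A = \sum_i (V i *t W i) *m A *m (V i *t W i) ->
  top_pair L A X Y ->
  (forall i, top_pair L A (V i *m X *m V i) (W i *m Y *m W i)) /\
  (forall i j, i != j -> V i *m X *m V j = 0).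
Proof.
move=> L_gt0 gA hV VV V1 hW WW W1 AE [hX hY g0].
have := gap_blocks L hV VV V1 hX hW WW W1 hY AE; rewrite g0 => /esym/eqP.
have dsum_ge0 k' (F : I -> I -> 'M[C]_k') :
    0 <= \sum_i \sum_(j | j != i) \tr (F i j *m (F i j)^t*).
  by do 2!rewrite sumr_ge0 // => ? _; exact: trmx_adj_ge0.
have g_ge0 i : 0 <= gap L A (V i *m X *m V i) (W i *m Y *m W i).
  by apply: gA; apply: herm_compress.
set S1 := \sum_i gap _ _ _ _.
have S1_ge0 : 0 <= S1 by rewrite sumr_ge0.
set S2 := \sum_i \sum_(j | _) _; set S3 := \sum_i \sum_(j | _) _.
have S2_ge0 : 0 <= S2 := dsum_ge0 _ _.
have S3_ge0 : 0 <= S3 := dsum_ge0 _ _.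
have S23 := addr_ge0 S2_ge0 S3_ge0.
rewrite paddr_eq0 ?(mulr_ge0 (ltW L_gt0) S23) // => /andP[S10].
rewrite mulf_eq0 gt_eqF //= (paddr_eq0 S2_ge0 S3_ge0) => /andP[S20 _].
split=> [i|i j ij].
  split; [exact: herm_compress|exact: herm_compress|].
  move: S10; rewrite psumr_eq0 // => /allP /(_ i (mem_index_enum _)) /=.
  by move/eqP.
move: S20; rewrite psumr_eq0 => [|i' _]; last first.
  by rewrite sumr_ge0 // => ? _; exact: trmx_adj_ge0.
move=> /allP /(_ i (mem_index_enum _)).
rewrite /= psumr_eq0 => [|j' _]; last exact: trmx_adj_ge0.
move=> /allP /(_ j (mem_index_enum _)).
by rewrite eq_sym ij /= => /eqP/trmx_adj_eq0.
Qed.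
End TopPair.

(** * Growing orthogonal families of positive semidefinite top pairs *)

Section TopPairs.
Context {R : realType}.
Local Notation C := R[i].
Context (k m : nat) (A : 'M[C]_(k * m)) (L : C).
Hypotheses (PA : PPT A) (L_gt0 : 0 < L).
Hypothesis gapA_ge0 : forall X Y,
  X \is hermsymmx -> Y \is hermsymmx -> 0 <= gap L A X Y.
Hypothesis top_trl : forall X Y Z,
  top_pair L A X Y -> \tr (A *m (X *t Z)) = L * \tr (Y *m Z).
Hypothesis top_trr : forall X Y Z,
  top_pair L A X Y -> \tr (A *m (Z *t Y)) = L * \tr (X *m Z).

(** Evaluate the trace of [A *m (X *t Y')] by the singular vector equation of either pair and cancel
    [L]. Orthonormality of the first members thus passes to the second ones. *)
Lemma top_pair_tr X Y X' Y' :
  top_pair L A X Y -> top_pair L A X' Y' -> \tr (X *m X') = \tr (Y *m Y').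
Proof.
move=> t t'; have := top_trl Y' t; rewrite (top_trr X t') => /(mulfI _) <-.
  exact: mxtrace_mulC.
by rewrite gt_eqF.
Qed.

(* Replacing [X] and [Y] by their absolute values can only decrease the gap. *)
Lemma top_pair_pos_part X Y P Q :
  top_pair L A X Y -> psd P -> psd (P - X) -> P *m (P - X) = 0 ->
  psd Q -> psd (Q - Y) -> Q *m (Q - Y) = 0 -> top_pair L A P Q.
Proof.
move=> [hX hY g0] pP; set N := P - X => pN PN pQ; set M := Q - Y => pM QM.
have XE : X = P - N by rewrite /N opprB addrC subrK.
have YE : Y = Q - M by rewrite /M opprB addrC subrK.
have [hP hN] := (psd_herm pP, psd_herm pN).
have [hQ hM] := (psd_herm pQ, psd_herm pM).
have b_ge0 V W : psd V -> psd W -> 0 <= \tr (A *m (V *t W)).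
  by move=> pV pW; apply: psd_tr_ge0 (psd_tens pV pW); case: PA.
have gE := gapB L A PN QM; rewrite -XE -YE g0 in gE.
have gPQ := gapA_ge0 hP hQ; have gNM := gapA_ge0 hN hM.
have bb : 0 <= 2%:R * (\tr (A *m (P *t M)) + \tr (A *m (N *t Q))).
  by rewrite mulr_ge0 ?ler0n // addr_ge0 ?b_ge0.
split; [exact: hP|exact: hQ|]; move/esym/eqP: gE.
by rewrite -addrA (paddr_eq0 gPQ (addr_ge0 gNM bb)) => /andP[/eqP].
Qed.

(* Complete reducibility: [A (P (x) (1 - W)) = 0] as its trace is
   [L tr (Q (1 - W)) = 0], and similarly for [(1 - U) (x) Q]; hence [A] splits. *)
Lemma top_pair_split P Q U W B B' X Y :
  top_pair L A P Q -> psd P -> psd Q ->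
  U \is hermsymmx -> U *m U = U -> U *m P = P -> U = B *m P ->
  W \is hermsymmx -> W *m W = W -> W *m Q = Q -> W = B' *m Q ->
  top_pair L A X Y ->
  [/\ top_pair L A (U *m X *m U) (W *m Y *m W),
      top_pair L A ((1%:M - U) *m X *m (1%:M - U))
                   ((1%:M - W) *m Y *m (1%:M - W))
    & U *m X *m (1%:M - U) = 0].
Proof.
move=> tPQ pP pQ hU UU UP UB hW WW WQ WB tXY.
pose V b := if b then U else 1%:M - U; pose V' b := if b then W else 1%:M - W.
have hV b : V b \is hermsymmx by case: b; [exact: hU|exact: herm_compl].
have hV' b : V' b \is hermsymmx by case: b; [exact: hW|exact: herm_compl].
have VV b : V b *m V b = V b by case: b; [exact: UU|exact: idem_compl].
have VV' b : V' b *m V' b = V' b by case: b; [exact: WW|exact: idem_compl].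
have pV b := psd_proj (hV b) (VV b); have pV' b := psd_proj (hV' b) (VV' b).
have V1 : \sum_b V b = 1%:M by rewrite big_bool /= addrC subrK.
have V1' : \sum_b V' b = 1%:M by rewrite big_bool /= addrC subrK.
have PU := herm_fixC hU (psd_herm pP) UP.
have QW := herm_fixC hW (psd_herm pQ) WQ.
(* The adjoint form puts [P] on the left of [U], next to [A], so that the vanishing of
   [A *m (P *t (1%:M - W))] carries over to [U]. *)
have UB' : U = P *m B^t*.
  by rewrite -(hermP hU) {1}UB adjmxM (hermP (psd_herm pP)).
have WB'' : W = Q *m B'^t*.
  by rewrite -(hermP hW) {1}WB adjmxM (hermP (psd_herm pQ)).
have Ublock : \tr (A *m (U *t (1%:M - W))) = 0.
  have [|AP _] := PPT_tr_eq0 PA pP (pV' false).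
    by rewrite (top_trl _ tPQ) /= mulmxBr mulmx1 QW subrr mxtrace0 mulr0.
  have -> : U *t (1%:M - W) = (P *t (1%:M - W)) *m (B^t* *t 1%:M).
    by rewrite tensmx_mul mulmx1 -UB'.
  by rewrite mulmxA AP mul0mx mxtrace0.
have Wblock : \tr (A *m ((1%:M - U) *t W)) = 0.
  have [|AQ _] := PPT_tr_eq0 PA (pV false) pQ.
    by rewrite (top_trr _ tPQ) /= mulmxBr mulmx1 PU subrr mxtrace0 mulr0.
  have -> : (1%:M - U) *t W = ((1%:M - U) *t Q) *m (1%:M *t B'^t*).
    by rewrite tensmx_mul mulmx1 -WB''.
  by rewrite mulmxA AQ mul0mx mxtrace0.
have VW0 b c : b != c -> \tr (A *m (V b *t V' c)) = 0.
  case: b c => [] [] ne; [| exact: Ublock | exact: Wblock |].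
    by case/eqP: (ne).
  by case/eqP: (ne).
have Ablock := PPT_block_diag PA pV pV' V1 V1' VW0.
have [tb ob] := gap_blocks_eq0 L_gt0 gapA_ge0 hV VV V1 hV' VV' V1' Ablock tXY.
split; [exact: (tb true)|exact: (tb false)|exact: (ob true false)].
Qed.

(** Only the first members are required to be nonzero and orthogonal; [top_pair_tr] transfers this
    to the second members. *)
Definition top_family p (f : 'I_p -> 'M[C]_k) (h : 'I_p -> 'M[C]_m) :=
  [/\ forall i, top_pair L A (f i) (h i), forall i, psd (f i) /\ psd (h i),
      forall i, f i != 0 & forall i j, i != j -> \tr (f i *m f j) = 0].

Lemma top_family_cons p (f : 'I_p -> 'M[C]_k) (h : 'I_p -> 'M[C]_m) X Y :
  top_family f h -> top_pair L A X Y -> psd X -> psd Y -> X != 0 ->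
  (forall i, \tr (X *m f i) = 0) ->
  exists (f' : 'I_p.+1 -> 'M[C]_k) (h' : 'I_p.+1 -> 'M[C]_m), top_family f' h'.
Proof.
move=> [tf pf f0 fo] tX pX pY X0 Xf.
exists (fun j => oapp f X (unlift ord0 j)), (fun j => oapp h Y (unlift ord0 j)).
split=> [j|j|j|i j].
- by case: unliftP => [j' _|_]; [exact: tf | exact: tX].
- by case: unliftP => [j' _|_]; [exact: pf | split; [exact: pX | exact: pY]].
- by case: unliftP => [j' _|_]; [exact: f0 | exact: X0].
case: (unliftP ord0 i) => [i'|] ->; case: (unliftP ord0 j) => [j'|] -> /=.
- by rewrite (inj_eq lift_inj) => /fo.
- by move=> _; rewrite mxtrace_mulC Xf.
- by move=> _; rewrite Xf.
- by [].
Qed.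

(** The member [f i0] is replaced by its compression by [U], and its compression by [1%:M - U] is
    added. As [U] commutes with [f i0], both are multiples [_ *m f i0], hence still orthogonal to
    the other members. *)
Lemma top_family_split p (f : 'I_p -> 'M[C]_k) (h : 'I_p -> 'M[C]_m) U W i0 :
  top_family f h -> U \is hermsymmx -> U *m U = U -> W \is hermsymmx ->
  (forall i, U *m f i *m (1%:M - U) = 0) ->
  top_pair L A (U *m f i0 *m U) (W *m h i0 *m W) ->
  top_pair L A ((1%:M - U) *m f i0 *m (1%:M - U))
               ((1%:M - W) *m h i0 *m (1%:M - W)) ->
  U *m f i0 *m U != 0 -> (1%:M - U) *m f i0 *m (1%:M - U) != 0 ->
  exists (f' : 'I_p.+1 -> 'M[C]_k) (h' : 'I_p.+1 -> 'M[C]_m), top_family f' h'.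
Proof.
move=> [tf pf f0 fo] hU UU hW fU0 t1 t2 n1 n2.
have hU' := herm_compl hU; have hW' := herm_compl hW.
have [pf0 ph0] := pf i0.
have ff j : j != i0 -> f i0 *m f j = 0.
  move=> ji; apply: psd_tr_eq0 pf0 (pf j).1 _.
  by apply: fo; rewrite eq_sym.
have Uf : U *m f i0 *m U = U *m f i0.
  exact: mulmx_compl_eq0.
have Uf' : (1%:M - U) *m f i0 *m (1%:M - U) = (1%:M - U) *m f i0.
  rewrite mulmxBl mul1mx mulmxBl fU0 subr0 mulmxBr mulmx1; congr (_ - _).
  have /(congr1 (fun Z => Z^t*)) := Uf.
  by rewrite !adjmxM (hermP hU) (hermP (psd_herm pf0)) mulmxA Uf.
pose f1 j := if j == i0 then U *m f i0 *m U else f j.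
pose h1 j := if j == i0 then W *m h i0 *m W else h j.
have F1 : top_family f1 h1.
  split=> [j|j|j|i j].
  - by rewrite /f1 /h1; case: (j == i0); [exact: t1 | exact: tf].
  - rewrite /f1 /h1; case: (j == i0); last exact: pf.
    by split; [exact: psd_compress hU pf0 | exact: psd_compress hW ph0].
  - by rewrite /f1; case: (j == i0); [exact: n1 | exact: f0].
  rewrite /f1; case: (eqVneq i i0) => [->|ii0]; case: (eqVneq j i0) => [_|ji0].
  - by [].
  - by move=> _; rewrite Uf -mulmxA ff // mulmx0 mxtrace0.
  - by move=> _; rewrite mxtrace_mulC Uf -mulmxA ff // mulmx0 mxtrace0.
  - exact: fo.
apply: (top_family_cons F1 t2 (psd_compress hU' pf0) (psd_compress hW' ph0) n2).
move=> j; rewrite /f1; case: (eqVneq j i0) => [_|ji0].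
  have UU' : U *m (1%:M - U) = 0 by rewrite mulmxBr mulmx1 UU subrr.
  rewrite mxtrace_mulC !mulmxA -[_ *m U *m _]mulmxA UU'.
  by rewrite mulmx0 !mul0mx mxtrace0.
by rewrite Uf' -mulmxA ff // mulmx0 mxtrace0.
Qed.

(* The spectral projection [U] of [X] on its positive part either splits some
   member of the family, or is orthogonal to all of them; in the second case
   the positive part of [X] joins the family. *)
Lemma top_family_extend p (f : 'I_p -> 'M[C]_k) (h : 'I_p -> 'M[C]_m) X Y :
  top_family f h -> top_pair L A X Y -> (forall i, \tr (X *m f i) = 0) ->
  ~ psd (- X) ->
  exists (f' : 'I_p.+1 -> 'M[C]_k) (h' : 'I_p.+1 -> 'M[C]_m), top_family f' h'.
Proof.
move=> F tXY Xf nX; have [tf pf f0 fo] := F; have [hX hY _] := tXY.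
have [U [B [[hU UU UX UB] [pP pN]]]] := herm_pos_part hX.
have [W [B' [[hW WW WY WB] [pQ pM]]]] := herm_pos_part hY.
have UP : U *m (U *m X) = U *m X by rewrite mulmxA UU.
have WQ : W *m (W *m Y) = W *m Y by rewrite mulmxA WW.
have PN := idem_pos_part UU UX; have QM := idem_pos_part WW WY.
have tPQ := top_pair_pos_part tXY pP pN PN pQ pM QM.
have spl i := top_pair_split tPQ pP pQ hU UU UP UB hW WW WQ WB (tf i).
have fU0 i : U *m f i *m (1%:M - U) = 0 by have [] := spl i.
have [i0 /andP[n1 n2]|none] := pickP (fun i =>
    (U *m f i *m U != 0) && ((1%:M - U) *m f i *m (1%:M - U) != 0)).
  have [t1 t2 _] := spl i0.
  exact: top_family_split F hU UU hW fU0 t1 t2 n1 n2.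
have Uf i : U *m f i *m U = U *m f i.
  exact: mulmx_compl_eq0.
have Uf0 i : U *m f i = 0.
  (* If [U *m f i] were nonzero, the complementary compression would vanish and [U] would fix [f i].
     Then the positive part of [X] has trace zero against [f i], hence annihilates it, and so does
     [U = B *m (U *m X)]. *)
  apply/eqP; apply: contraT => n1; have := none i; rewrite Uf n1 /= => /negbFE.
  rewrite mulmxBl mul1mx mulmxBl fU0 subr0 mulmxBr mulmx1 subr_eq0 => /eqP fU.
  have fUf : U *m f i = f i.
    rewrite -[RHS](hermP (psd_herm (pf i).1)) [in RHS]fU adjmxM (hermP hU).
    by rewrite (hermP (psd_herm (pf i).1)).
  have Pf : U *m X *m f i = 0.
    by apply: psd_tr_eq0 pP (pf i).1 _; rewrite UX -mulmxA fUf Xf.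
  by move: n1; rewrite UB -mulmxA Pf mulmx0 eqxx.
apply: (top_family_cons F tPQ pP pQ) => [|i].
  by apply/eqP => P0; apply: nX; rewrite P0 sub0r in pN.
by rewrite UX -mulmxA Uf0 mulmx0 mxtrace0.
Qed.
End TopPairs.

(** * Orthogonal changes of Schmidt families *)

Section OrthogonalChange.
Context {C : numClosedFieldType}.

Lemma sum_tens_orthogonal n k m (c : 'M[C]_n) (X : 'I_n -> 'M[C]_k)
    (Y : 'I_n -> 'M[C]_m) : c^T *m c = 1%:M ->
  \sum_i (\sum_j c i j *: X j) *t (\sum_j c i j *: Y j) = \sum_i X i *t Y i.
Proof.
move=> cc.
transitivity (\sum_j \sum_j' (c^T *m c) j j' *: (X j *t Y j')).
  under eq_bigr do rewrite tensmx_suml.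
  rewrite exchange_big; apply: eq_bigr => j _ /=.
  under eq_bigr do rewrite tensmx_sumr.
  rewrite exchange_big; apply: eq_bigr => j' _ /=.
  rewrite mxE scaler_suml; apply: eq_bigr => i _.
  by rewrite tensmxZl tensmxZr scalerA mxE.
apply: eq_bigr => j _; rewrite cc (bigD1 j) //= mxE eqxx scale1r.
by rewrite big1 ?addr0 // => j' jj'; rewrite mxE eq_sym (negPf jj') scale0r.
Qed.

(** The common sum is a Schmidt expansion with all coefficients 1, for which [(g2 i, d2 i)] has zero
    gap; [gap_eq0] then gives both members the same coordinates. *)
Lemma sum_tens_coord n k m (g1 g2 : 'I_n -> 'M[C]_k)
    (d1 d2 : 'I_n -> 'M[C]_m) i :
  orthonormal g1 -> orthonormal d1 -> orthonormal g2 -> orthonormal d2 ->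
  \sum_j g1 j *t d1 j = \sum_j g2 j *t d2 j ->
  g2 i = \sum_j \tr (g1 j *m g2 i) *: g1 j /\
  d2 i = \sum_j \tr (g1 j *m g2 i) *: d1 j.
Proof.
move=> og1 od1 og2 od2 DE.
have aT1 (j : 'I_n) : predT j -> (1 : C) = 1 by [].
have aT2 (j : 'I_n) : ~~ predT j -> 0 <= (1 : C) < 1 by [].
apply: (@gap_eq0 _ _ _ _ predT 1 (fun=> 1) g1 d1 ltr01 aT1 aT2 og1 od1).
- exact: og2.1.
- exact: od2.1.
have -> : \sum_j 1 *: (g1 j *t d1 j) = \sum_j 1 *: (g2 j *t d2 j).
  under eq_bigr do rewrite scale1r; rewrite DE.
  by under [RHS]eq_bigr do rewrite scale1r.
rewrite /gap tr_schmidt og2.2 od2.2 eqxx (bigD1 i) //= big1 => [|j ji].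
  by rewrite og2.2 od2.2 eqxx !mulr1n; ring.
by rewrite og2.2 (negPf ji) mul0r mulr0.
Qed.

Lemma coord_orthogonal n k (X X' : 'I_n -> 'M[C]_k) :
  orthonormal X -> orthonormal X' ->
  (forall i, X' i = \sum_j \tr (X j *m X' i) *: X j) ->
  let c := \matrix_(i, j) \tr (X j *m X' i) in
  c *m c^T = 1%:M /\ c^T *m c = 1%:M.
Proof.
move=> oX oX' X'E c; suff cc : c *m c^T = 1%:M by split=> //; exact: mulmx1C.
apply/matrixP => i j; rewrite !mxE -oX'.2 [in RHS]X'E mulmx_suml raddf_sum.
by apply: eq_bigr => a _; rewrite !mxE -scalemxAl /= mxtraceZ.
Qed.

(** Orthogonality of two rows with nonnegative entries holds term by term, so each column has at
    most one nonzero entry, which its unit norm forces to be 1. *)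
Lemma nonneg_orthogonal_perm n (c : 'M[C]_n) :
  (forall i j, 0 <= c i j) -> c *m c^T = 1%:M -> c^T *m c = 1%:M ->
  exists sigma : 'S_n, forall i j, c i j = (j == sigma i)%:R.
Proof.
move=> c_ge0 cc cc'.
have rowE i i' : \sum_j c i j * c i' j = (i == i')%:R.
  have /matrixP /(_ i i') := cc; rewrite !mxE => <-.
  by apply: eq_bigr => j _; rewrite mxE.
have colE j : \sum_i c i j * c i j = 1.
  have /matrixP /(_ j j) := cc'; rewrite !mxE eqxx mulr1n => <-.
  by apply: eq_bigr => i _; rewrite mxE.
have c2_ge0 i i' j : 0 <= c i j * c i' j by rewrite mulr_ge0.
have excl i i' j : i != i' -> c i j * c i' j = 0.
  move=> ii'; have /eqP := rowE i i'; rewrite (negPf ii') psumr_eq0 //.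
  by move=> /allP /(_ j (mem_index_enum _)) /= /eqP.
(* The default is never reached: a row of norm 1 has a nonzero entry. *)
pose f i := odflt i [pick j | c i j != 0].
have fP i : c i (f i) != 0.
  rewrite /f; case: pickP => //= c0; have := rowE i i; rewrite eqxx big1.
    by move=> /eqP; rewrite eq_sym oner_eq0.
  by move=> j _; move/negbFE/eqP: (c0 j) => ->; rewrite mul0r.
have f_inj : injective f.
  move=> i i' fii'; apply/eqP; apply: contraT => /(excl _ _ (f i))/eqP.
  by rewrite mulf_eq0 {2}fii' (negPf (fP i)) (negPf (fP i')).
have cf i : c i (f i) = 1.
  have := colE (f i); rewrite (bigD1 i) //= big1 ?addr0 => [|i' ii'].
    by move=> /eqP; rewrite -expr2 sqrp_eq1 // => /eqP.
  rewrite eq_sym in ii'; have /eqP := excl _ _ (f i) ii'.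
  by rewrite mulf_eq0 (negPf (fP i)) /= => /eqP ->; rewrite mul0r.
exists (perm f_inj) => i j; rewrite permE.
case: (eqVneq j (f i)) => [->|jf]; first exact: cf.
have := rowE i i; rewrite eqxx (bigD1 (f i)) //= cf mulr1.
rewrite -[RHS]addr0 => /addrI /eqP; rewrite psumr_eq0 //.
move=> /allP /(_ j (mem_index_enum _)); rewrite jf /= mulf_eq0 orbb => /eqP.
by [].
Qed.
End OrthogonalChange.

(** * Uniqueness of the positive semidefinite decomposition *)

Section PsdSchmidt.
Context {R : realType}.
Local Notation C := R[i].

Lemma orthonormal_hermP n k (g : 'I_n -> 'M[C]_k) :
  orthonormal_herm g <-> orthonormal g.
Proof.
split=> -[gh go]; split=> // i j; first by rewrite -go hsdotE.
by rewrite hsdotE // go.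
Qed.

Lemma psd_schmidtP s k m (D : 'M[C]_(k * m)) (g : 'I_s -> 'M[C]_k)
    (d : 'I_s -> 'M[C]_m) :
  psd_schmidt D g d <->
  [/\ orthonormal g, orthonormal d, D = \sum_i g i *t d i,
      forall i, psd (g i) & forall i, psd (d i)].
Proof.
have sumE : \sum_i (1 : R)%:C *: (g i *t d i) = \sum_i g i *t d i.
  by apply: eq_bigr => i _; rewrite scale1r.
split=> [[[_ /orthonormal_hermP og /orthonormal_hermP od DE] pg pd]|].
  by split=> //; rewrite DE sumE.
move=> [/orthonormal_hermP og /orthonormal_hermP od DE pg pd]; split=> //.
by split=> //; rewrite DE sumE.
Qed.

Lemma psd_opp_eq0 n (X : 'M[C]_n) : psd X -> psd (- X) -> X = 0.
Proof.
move=> pX pNX; apply: tr_herm_eq0 (psd_herm pX) _; apply/le_anti.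
rewrite tr_herm_ge0 ?(psd_herm pX) // andbT.
by have := psd_tr_ge0 pX pNX; rewrite mulmxN raddfN /= oppr_ge0.
Qed.

(** The change of coordinates is orthogonal, and its entries are traces of products of positive
    semidefinite matrices, hence nonnegative. *)
Lemma psd_schmidt_unique s k m (D : 'M[C]_(k * m)) (g1 g2 : 'I_s -> 'M[C]_k)
    (d1 d2 : 'I_s -> 'M[C]_m) :
  psd_schmidt D g1 d1 -> psd_schmidt D g2 d2 ->
  exists sigma : 'S_s, forall i, g2 i = g1 (sigma i) /\ d2 i = d1 (sigma i).
Proof.
move=> /psd_schmidtP[og1 od1 DE1 pg1 pd1] /psd_schmidtP[og2 od2 DE2 pg2 pd2].
have E i := sum_tens_coord i og1 od1 og2 od2 (etrans (esym DE1) DE2).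
have [cc cc'] := coord_orthogonal og1 og2 (fun i => (E i).1).
have [|sigma cE] := nonneg_orthogonal_perm _ cc cc'.
  by move=> i j; rewrite mxE psd_tr_ge0.
have trE i j : \tr (g1 j *m g2 i) = (j == sigma i)%:R by rewrite -cE mxE.
have sum1 k' (X : 'I_s -> 'M[C]_k') i :
    \sum_j \tr (g1 j *m g2 i) *: X j = X (sigma i).
  rewrite (bigD1 (sigma i)) //= trE eqxx scale1r big1 ?addr0 // => j ji.
  by rewrite trE (negPf ji) scale0r.
by exists sigma => i; rewrite (E i).1 (E i).2 !sum1.
Qed.

End PsdSchmidt.

(** * Existence of the positive semidefinite decomposition *)

Section Existence.
Context {R : realType}.
Local Notation C := R[i].
Context (k m s : nat) (A : 'M[C]_(k * m)) (L : C).
Context (G : 'I_s -> 'M[C]_k) (D : 'I_s -> 'M[C]_m).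
Hypotheses (PA : PPT A) (L_gt0 : 0 < L).
Hypothesis gapA_ge0 : forall X Y,
  X \is hermsymmx -> Y \is hermsymmx -> 0 <= gap L A X Y.
Hypothesis top_trl : forall X Y Z,
  top_pair L A X Y -> \tr (A *m (X *t Z)) = L * \tr (Y *m Z).
Hypothesis top_trr : forall X Y Z,
  top_pair L A X Y -> \tr (A *m (Z *t Y)) = L * \tr (X *m Z).
Hypothesis oG : orthonormal G.
Hypothesis top_span : forall c : 'I_s -> R,
  top_pair L A (\sum_j (c j)%:C *: G j) (\sum_j (c j)%:C *: D j).
Hypothesis top_coord : forall X Y, top_pair L A X Y ->
  X = \sum_j \tr (G j *m X) *: G j /\ Y = \sum_j \tr (G j *m X) *: D j.

(** A dimension count: [p] linear conditions on [s] real coefficients, [p < s]. It is done over [R],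
    as the traces are real and real coefficients keep the combinations Hermitian. *)
Lemma top_pair_ortho_exists p (f : 'I_p -> 'M[C]_k) : (p < s)%N ->
  (forall i, f i \is hermsymmx) ->
  exists X Y, [/\ top_pair L A X Y, X != 0 & forall i, \tr (X *m f i) = 0].
Proof.
move=> ps hf; pose N := \matrix_(j < s, i < p) complex.Re (\tr (G j *m f i)).
have /rowV0Pn [v /sub_kermxP vN v0] : kermx N != 0.
  rewrite kermx_eq0 /row_free neq_ltn.
  by rewrite (leq_ltn_trans (rank_leq_col N) ps).
exists (\sum_j (v 0 j)%:C *: G j), (\sum_j (v 0 j)%:C *: D j).
split=> [||i]; first exact: top_span.
  apply: contraNneq v0 => X0; apply/eqP/rowP => j.
  have := tr_orthonormal_sum predT (fun j => (v 0 j)%:C) j oG.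
  by rewrite X0 mulmx0 mxtrace0 mxE => /esym [].
rewrite mulmx_suml raddf_sum /=; have /matrixP /(_ 0 i) := vN.
rewrite !mxE => /(congr1 (real_complex R)); rewrite rmorph_sum /= => vN0.
rewrite -[RHS]vN0; apply: eq_bigr => j _.
rewrite -scalemxAl mxtraceZ mxE rmorphM /= RRe_real //.
by rewrite tr_herm_real // oG.1.
Qed.

Lemma top_family_exists p : (p <= s)%N ->
  exists (f : 'I_p -> 'M[C]_k) (h : 'I_p -> 'M[C]_m), top_family A L f h.
Proof.
elim: p => [_|p IHp ps]; first by exists (fun=> 0), (fun=> 0); split=> -[].
have [f [h F]] := IHp (ltnW ps); have [tf pf _ _] := F.
have hf i := psd_herm (pf i).1.
have [X [Y [tX X0 Xf]]] := top_pair_ortho_exists ps hf.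
have ext := top_family_extend PA L_gt0 gapA_ge0 top_trl top_trr F.
(* The extension needs a positive eigenvalue; if [X] has none, [- X] does, for otherwise [X] would
   be zero. *)
have [pNX|pNX] := boolp.EM (psd (- X)); last exact: ext tX Xf pNX.
have tNX := top_pairZ (rpredN1 _) tX.
apply: (ext _ _ tNX) => [i|]; rewrite !scaleN1r.
  by rewrite mulNmx raddfN /= Xf oppr0.
rewrite opprK => pX; move: X0; rewrite (psd_opp_eq0 pX pNX) eqxx.
by [].
Qed.

Lemma psd_schmidt_exists : exists (g' : 'I_s -> 'M[C]_k) (d' : 'I_s -> 'M[C]_m),
  psd_schmidt (\sum_j G j *t D j) g' d'.
Proof.
have [f [h [tf pf f0 fo]]] := top_family_exists (leqnn s).
have hf i := psd_herm (pf i).1.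
have t_gt0 i : 0 < \tr (f i *m f i).
  rewrite lt_def tr_herm_ge0 ?hf // andbT.
  by apply: contraNneq (f0 i) => /(tr_herm_eq0 (hf i)) ->.
(* One scalar normalizes both members of the pair, since their norms agree by [top_pair_tr]. *)
pose r i := (sqrtC (\tr (f i *m f i)))^-1.
have r_ge0 i : 0 <= r i by rewrite invr_ge0 sqrtC_ge0 ltW.
have tg i : top_pair L A (r i *: f i) (r i *: h i).
  by apply: top_pairZ (tf i); rewrite ger0_real.
have og : orthonormal (fun i => r i *: f i).
  split=> [i|i j]; first by have [] := tg i.
  rewrite -scalemxAl -scalemxAr !mxtraceZ; case: (eqVneq i j) => [<-|ij].
    rewrite mulrA -expr2 exprVn sqrtCK mulVf //.
    by rewrite gt_eqF ?t_gt0.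
  by rewrite fo // !mulr0.
have od : orthonormal (fun i => r i *: h i).
  split=> [i|i j]; first by have [] := tg i.
  by rewrite -(top_pair_tr L_gt0 top_trl top_trr (tg i) (tg j)) og.2.
exists (fun i => r i *: f i), (fun i => r i *: h i); apply/psd_schmidtP; split.
- exact: og.
- exact: od.
(* The new pairs arise from [(G, D)] by one orthogonal matrix acting on both factors, which
   preserves the sum of tensors. *)
- have [_ cc] := coord_orthogonal oG og (fun i => (top_coord (tg i)).1).
  rewrite -(sum_tens_orthogonal G D cc); apply: eq_bigr => i _.
  have [fE hE] := top_coord (tg i); congr (_ *t _).
    by rewrite [RHS]fE; apply: eq_bigr => j _; rewrite mxE.
  by rewrite [RHS]hE; apply: eq_bigr => j _; rewrite mxE.
- by move=> i; apply: psdZ (r_ge0 i) (pf i).1.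
- by move=> i; apply: psdZ (r_ge0 i) (pf i).2.
Qed.
End Existence.

(** * Support projections of an orthogonal family *)

Section SupportProjections.
Context {R : realType}.
Local Notation C := R[i].
Context (s k : nat) (g : 'I_s -> 'M[C]_k).
Hypotheses (g_psd : forall i, psd (g i))
  (g_ortho : forall i j, i != j -> g i *m g j = 0).

Lemma supp_proj_herm i : supp_proj g i \is hermsymmx.
Proof.
by rewrite /supp_proj; case: unliftP => [j|] _; exact: herm_proj_herm.
Qed.

Lemma supp_proj_idem i : supp_proj g i *m supp_proj g i = supp_proj g i.
Proof.
by rewrite /supp_proj; case: unliftP => [j|] _; exact: herm_proj_idem.
Qed.

Lemma supp_proj_psd i : psd (supp_proj g i).
Proof. exact: psd_proj (supp_proj_herm i) (supp_proj_idem i). Qed.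

Lemma supp_projE j : supp_proj g (lift ord_max j) = herm_proj (im (g j)).
Proof. by rewrite /supp_proj liftK. Qed.

Lemma supp_proj_max :
  supp_proj g ord_max = herm_proj (orthocompl (\sum_(j < s) im (g j))%MS).
Proof. by rewrite /supp_proj unlift_none. Qed.

(** This lets the vanishing of [A] against a tensor with [g j] pass to the projection. *)
Lemma supp_proj_factor j : exists B, supp_proj g (lift ord_max j) = g j *m B.
Proof.
have /submxP[B BE] : ((herm_proj (im (g j)))^T <= im (g j))%MS.
  by rewrite trmxK proj_orthoE.
exists B^T; rewrite supp_projE -[LHS]trmxK BE trmx_mul.
by rewrite /im trmxK.
Qed.

Lemma im_ortho i j : i != j -> (im (g i) <= orthocompl (im (g j)))%MS.
Proof.
move=> ij; apply/orthomx1P; rewrite /im trmxK.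
have gj : map_mx Num.conj (g j) = (g j)^T.
  by rewrite -[in RHS](hermP (psd_herm (g_psd j))) map_trmx trmxK.
by rewrite gj -trmx_mul g_ortho ?trmx0 // eq_sym.
Qed.

Lemma supp_proj_mul i j :
  supp_proj g j *m g i = if j == lift ord_max i then g i else 0.
Proof.
apply: trmx_inj; rewrite trmx_mul; case: (unliftP ord_max j) => [j'|] ->.
  rewrite supp_projE trmxK (inj_eq lift_inj).
  case: (eqVneq j' i) => [->|ji]; first by rewrite proj_ortho_id.
  by rewrite trmx0 proj_ortho_0 // im_ortho // eq_sym.
rewrite (negPf (neq_lift _ _)) supp_proj_max trmxK trmx0 proj_ortho_0 //.
by rewrite /orthocompl ortho_id (sumsmx_sup i).
Qed.

Lemma mul_supp_proj i j :
  g i *m supp_proj g j = if j == lift ord_max i then g i else 0.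
Proof.
have hg := hermP (psd_herm (g_psd i)); have hV := hermP (supp_proj_herm j).
rewrite -{1}hg -{1}hV -adjmxM supp_proj_mul; case: ifP => _; first exact: hg.
by rewrite trmx0 map_mx0.
Qed.

(** On row spaces, the difference [N] kills both the sum [S] of the images and its orthogonal
    complement, which together span everything. *)
Lemma sum_supp_proj : \sum_i supp_proj g i = 1%:M.
Proof.
set S := (\sum_(j < s) im (g j))%MS.
suff : (1%:M - \sum_i supp_proj g i)^T = 0.
  by move=> /(congr1 trmx); rewrite trmxK trmx0 => /subr0_eq ->.
set N := (_ - _)^T; suff : (1%:M <= kermx N)%MS.
  by move/sub_kermxP; rewrite mul1mx.
rewrite -(addsmx_ortho S) addsmx_sub; apply/andP; split.
  apply/sumsmx_subP => i _; apply/sub_kermxP; rewrite /N -trmx_mul.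
  rewrite mulmxBl mul1mx mulmx_suml (bigD1 (lift ord_max i)) //=.
  rewrite big1 => [|j ji].
    by rewrite supp_proj_mul eqxx addr0 subrr trmx0.
  by rewrite supp_proj_mul (negPf ji).
apply/sub_kermxP; rewrite /N linearB /= trmx1 mulmxBr mulmx1 linear_sum /=.
rewrite mulmx_sumr (bigD1 ord_max) //= big1 => [|j]; last first.
  case: (unliftP ord_max j) => [j' ->|->]; last by rewrite eqxx.
  move=> _; rewrite supp_projE trmxK; apply: proj_ortho_0.
  by rewrite submx_ortho (sumsmx_sup j').
by rewrite addr0 supp_proj_max trmxK proj_ortho_id ?subrr.
Qed.

(** The [i]-th projection fixes [g i] and kills every other [g j], so it separates the [i]-th image
    from the sum of the others. *)
Lemma mxdirect_im : mxdirect (\sum_(i < s) im (g i)).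
Proof.
apply/mxdirect_sumsP => i _; apply/eqP/rowV0P => v; rewrite sub_capmx.
case/andP => /submxP[u ->] uS.
have /sub_kermxP : (u *m im (g i) <= kermx (supp_proj g (lift ord_max i))^T)%MS.
  apply: submx_trans uS _; apply/sumsmx_subP => j /= ji; apply/sub_kermxP.
  by rewrite -trmx_mul supp_proj_mul (inj_eq lift_inj) eq_sym (negPf ji) trmx0.
by rewrite -mulmxA -trmx_mul supp_proj_mul eqxx.
Qed.
End SupportProjections.

(** * Application to the top Schmidt coefficient and the block decomposition *)

Section TopSchmidt.
Context {R : realType}.
Local Notation C := R[i].
Context (k m n s : nat) (A : 'M[C]_(k * m)) (l : 'I_n -> R).
Context (g : 'I_n -> 'M[C]_k) (d : 'I_n -> 'M[C]_m) (i0 : 'I_n).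
Hypotheses (APPT : PPT A) (Aschmidt : herm_schmidt A l g d).
Hypotheses (s_le_n : (s <= n)%N) (i0s : (i0 < s)%N).
Hypothesis l_top : forall i j : 'I_n, (i < s)%N -> (j < s)%N -> l i = l j.
Hypothesis l_gap : forall i j : 'I_n, (i < s)%N -> (s <= j)%N -> l j < l i.

Let L : C := (l i0)%:C.
Let T (i : 'I_n) := (i < s)%N.
Let D : 'M[C]_(k * m) := \sum_(i < n | T i) g i *t d i.

Let og : orthonormal g.
Proof. by case: Aschmidt => _ /orthonormal_hermP. Qed.

Let od : orthonormal d.
Proof. by case: Aschmidt => _ _ /orthonormal_hermP. Qed.

Let AE : A = \sum_i (l i)%:C *: (g i *t d i).
Proof. by case: Aschmidt. Qed.

Let L_gt0 : 0 < L.
Proof. by case: Aschmidt => l_gt0 _ _ _; rewrite /L ltcR. Qed.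

Let aT i : T i -> (l i)%:C = L.
Proof. by move=> Ti; rewrite /L (l_top Ti i0s). Qed.

Let aNT i : ~~ T i -> 0 <= (l i)%:C < L.
Proof.
rewrite -leqNgt => si; case: Aschmidt => l_gt0 _ _ _.
by rewrite lecR ltcR ltW //= l_gap.
Qed.

Let top_ge0 X Y : X \is hermsymmx -> Y \is hermsymmx -> 0 <= gap L A X Y.
Proof. by rewrite AE => hX hY; exact: (gap_ge0 L_gt0 aT aNT og od hX hY). Qed.

Let top_trl X Y Z :
  top_pair L A X Y -> \tr (A *m (X *t Z)) = L * \tr (Y *m Z).
Proof.
rewrite AE => -[hX hY g0].
exact: (tr_gap_eq0 L_gt0 aT aNT og od Z hX hY g0).
Qed.

Let top_trr X Y Z :
  top_pair L A X Y -> \tr (A *m (Z *t Y)) = L * \tr (X *m Z).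
Proof.
rewrite AE => -[hX hY g0].
exact: (tr_gap_eq0r L_gt0 aT aNT og od Z hX hY g0).
Qed.

Let G j := g (widen_ord s_le_n j).
Let H j := d (widen_ord s_le_n j).

Let oG : orthonormal G.
Proof. by split=> [i|i j]; [exact: og.1|rewrite og.2]. Qed.

Let oH : orthonormal H.
Proof. by split=> [i|i j]; [exact: od.1|rewrite od.2]. Qed.

Let DE : D = \sum_j G j *t H j.
Proof. exact: big_ord_narrow. Qed.

Let top_coord X Y : top_pair L A X Y ->
  X = \sum_j \tr (G j *m X) *: G j /\ Y = \sum_j \tr (G j *m X) *: H j.
Proof.
rewrite AE => -[hX hY g0].
have [XE YE] := gap_eq0 L_gt0 aT aNT og od hX hY g0.
by split; [rewrite {1}XE|rewrite {1}YE]; exact: big_ord_narrow.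
Qed.

Let top_span (c : 'I_s -> R) :
  top_pair L A (\sum_j (c j)%:C *: G j) (\sum_j (c j)%:C *: H j).
Proof.
have cr j : (c j)%:C \is Num.real by apply/complex_realP; exists (c j).
split; first by apply: herm_sum => j _; apply: hermZ (cr j) (oG.1 j).
  by apply: herm_sum => j _; apply: hermZ (cr j) (oH.1 j).
(* Extends [c] by zero to all of ['I_n], to match the sums filtered by [T]. *)
pose c' (i : 'I_n) : C :=
  oapp (fun j => (c j)%:C) 0 (insub (val i) : option 'I_s).
have c'E j : c' (widen_ord s_le_n j) = (c j)%:C by rewrite /c' /= valK.
have sumE k' (X : 'I_n -> 'M[C]_k') :
    \sum_j (c j)%:C *: X (widen_ord s_le_n j) = \sum_(i | T i) c' i *: X i.
  rewrite (big_ord_narrow s_le_n); apply: eq_bigr => j _.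
  by rewrite c'E.
rewrite /G /H !sumE AE; exact: (gap_span aT og od c').
Qed.

Lemma top_psd_schmidt_exists :
  exists (g' : 'I_s -> 'M[C]_k) (d' : 'I_s -> 'M[C]_m), psd_schmidt D g' d'.
Proof.
rewrite DE.
exact: (psd_schmidt_exists APPT L_gt0 top_ge0 top_trl top_trr oG top_span
  top_coord).
Qed.

Section Decomposition.
Context (g' : 'I_s -> 'M[C]_k) (d' : 'I_s -> 'M[C]_m).
Hypothesis gd' : psd_schmidt D g' d'.

Let og' : orthonormal g'. Proof. by have /psd_schmidtP[] := gd'. Qed.
Let od' : orthonormal d'. Proof. by have /psd_schmidtP[] := gd'. Qed.

Let pg' i : psd (g' i).
Proof. by have /psd_schmidtP[_ _ _ + _] := gd'; apply. Qed.

Let pd' i : psd (d' i).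
Proof. by have /psd_schmidtP[_ _ _ _ +] := gd'; apply. Qed.

Let g'_ortho i j : i != j -> g' i *m g' j = 0.
Proof.
by move=> ij; apply: psd_tr_eq0 (pg' i) (pg' j) _; rewrite og'.2 (negPf ij).
Qed.

Let d'_ortho i j : i != j -> d' i *m d' j = 0.
Proof.
by move=> ij; apply: psd_tr_eq0 (pd' i) (pd' j) _; rewrite od'.2 (negPf ij).
Qed.

Let top_gd' i : top_pair L A (g' i) (d' i).
Proof.
have /psd_schmidtP[_ _ DE' _ _] := gd'; rewrite DE in DE'.
have [gE dE] := sum_tens_coord i oG oH og' od' DE'.
(* [top_span] takes real coefficients, and the coordinates are real as traces of products of two
   Hermitian matrices. *)
have cr j : \tr (G j *m g' i) = (complex.Re (\tr (G j *m g' i)))%:C.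
  by rewrite RRe_real // tr_herm_real ?oG.1 ?og'.1.
have gE' : g' i = \sum_j (complex.Re (\tr (G j *m g' i)))%:C *: G j.
  by rewrite {1}gE; apply: eq_bigr => j _; rewrite -cr.
have dE' : d' i = \sum_j (complex.Re (\tr (G j *m g' i)))%:C *: H j.
  by rewrite {1}dE; apply: eq_bigr => j _; rewrite -cr.
have := top_span (fun j => complex.Re (\tr (G j *m g' i))).
by rewrite -gE' -dE'.
Qed.

Let V := supp_proj g'.
Let W := supp_proj d'.

(** Distinct [i] and [j] are not both [ord_max], so one projection factors through a member of a top
    pair. The singular vector equation moves the trace to the partner of that member, which the
    other projection annihilates. *)
Let tr_VW i j : i != j -> \tr (A *m (V i *t W j)) = 0.
Proof.
rewrite /V /W; have pV := supp_proj_psd g'; have pW := supp_proj_psd d'.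
case: (unliftP ord_max i) => [i'|] ->; last first.
  case: (unliftP ord_max j) => [j'|] -> ij; last by rewrite eqxx in ij.
  have [|AV _] := PPT_tr_eq0 APPT (pV ord_max) (pd' j').
    rewrite (top_trr _ (top_gd' j')) mul_supp_proj //.
    by rewrite (negPf ij) mxtrace0 mulr0.
  have [B ->] := supp_proj_factor d' j'.
  rewrite -[supp_proj g' ord_max]mulmx1 -tensmx_mul mulmxA AV.
  by rewrite mul0mx mxtrace0.
rewrite eq_sym => ij; have [|AW _] := PPT_tr_eq0 APPT (pg' i') (pW j).
  rewrite (top_trl _ (top_gd' i')) mul_supp_proj //.
  by rewrite (negPf ij) mxtrace0 mulr0.
have [B ->] := supp_proj_factor g' i'.
by rewrite -[supp_proj d' j]mulmx1 -tensmx_mul mulmxA AW mul0mx mxtrace0.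
Qed.

Lemma top_psd_schmidt_blocks :
  [/\ mxdirect (\sum_(i < s) im (g' i)),
      mxdirect (\sum_(i < s) im (d' i)),
      A = \sum_(i < s.+1) (V i *t W i) *m A *m (V i *t W i)
    & forall i : 'I_s.+1, PPT ((V i *t W i) *m A *m (V i *t W i))].
Proof.
split.
- exact: mxdirect_im.
- exact: mxdirect_im.
- apply: PPT_block_diag APPT (supp_proj_psd g') (supp_proj_psd d') _ _ tr_VW.
  + exact: sum_supp_proj.
  + exact: sum_supp_proj.
- by move=> i; apply: PPT_compress APPT; exact: supp_proj_herm.
Qed.
End Decomposition.
End TopSchmidt.

Theorem theorem2p11 (R : realType) (k m n s : nat)
    (A : 'M[R[i]]_(k * m)) (l : 'I_n -> R)
    (g : 'I_n -> 'M[R[i]]_k) (d : 'I_n -> 'M[R[i]]_m)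
    (APPT : PPT A)
    (Aschmidt : herm_schmidt A l g d)
    (s_gt0 : (0 < s)%N) (s_le_n : (s <= n)%N)
    (l_top : forall i j : 'I_n, (i < s)%N -> (j < s)%N -> l i = l j)
    (l_gap : forall i j : 'I_n, (i < s)%N -> (s <= j)%N -> l j < l i)
    (l_noninc : forall i j : 'I_n, (s <= i)%N -> (i <= j)%N -> l j <= l i) :
  let D : 'M[R[i]]_(k * m) := \sum_(i < n | (i < s)%N) g i *t d i in
  (exists (g' : 'I_s -> 'M[R[i]]_k) (d' : 'I_s -> 'M[R[i]]_m),
     psd_schmidt D g' d' /\
     forall (g'' : 'I_s -> 'M[R[i]]_k) (d'' : 'I_s -> 'M[R[i]]_m),
       psd_schmidt D g'' d'' ->
       exists sigma : 'S_s, forall i,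
         g'' i = g' (sigma i) /\ d'' i = d' (sigma i)) /\
  (forall (g' : 'I_s -> 'M[R[i]]_k) (d' : 'I_s -> 'M[R[i]]_m),
     psd_schmidt D g' d' ->
     let V := supp_proj g' in
     let W := supp_proj d' in
     [/\ mxdirect (\sum_(i < s) im (g' i)),
         mxdirect (\sum_(i < s) im (d' i)),
         A = \sum_(i < s.+1) (V i *t W i) *m A *m (V i *t W i)
       & forall i : 'I_s.+1, PPT ((V i *t W i) *m A *m (V i *t W i))]).
Proof.
(* Index 0 lies below [s], so [l i0] serves as the top coefficient. *)
pose i0 := Ordinal (leq_trans s_gt0 s_le_n).
have i0s : (i0 < s)%N := s_gt0.
split; last first.
  move=> g' d' gd'.
  exact: (top_psd_schmidt_blocks APPT Aschmidt s_le_n i0s l_top l_gap gd').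
have [g' [d' gd']] :=
  top_psd_schmidt_exists APPT Aschmidt s_le_n i0s l_top l_gap.
exists g', d'; split=> [|g'' d'']; first exact: gd'.
exact: psd_schmidt_unique.
Qed.
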